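(* Let $n\ge2$. For each $\lambda\in\mathbb{C}\smallsetminus\{0\}$, the closure within $\widehat{\mathcal{M}}$ of the affine algebraic curve $\mathrm{Per}_1(\lambda)\subset\mathcal{M}$ is a smooth compact algebraic curve $\overline{\mathrm{Per}}_1(\lambda)\subset\widehat{\mathcal{M}}$, which can be described as the image of a smooth section of the complex line bundle $X:\widehat{\mathcal{M}}\to\widehat{\mathbb{C}}$. The intersection $\overline{\mathrm{Per}}_1(\lambda)\cap L_\infty$ of this curve with the line at infinity consists of the single point with coordinates $$\hat X=0,\qquad \hat\sigma_1=\lambda+\lambda^{-1}.$$
   Context: A rational map $f:\widehat{\mathbb{C}}\to\widehat{\mathbb{C}}$ of degree $n\ge2$ is bicritical if it has exactly two critical points. $\mathcal{M}$ denotes the set of conjugacy classes $(f)$ of degree $n$ bicritical maps under Möbius conjugation. Every bicritical map is conjugate to one of the form $f(z)=(az^n+b)/(cz^n+d)$ with $ad-bc\ne0$; the quantities $X=bc/(ad-bc)$ and $Y=\big(a^{n+1}b^{n-1}+c^{n-1}d^{n+1}\big)/(ad-bc)^n$ depend only on $(f)$, and $(X,Y)$ identifies $\mathcal{M}$ with $\mathbb{C}^2$. $\mathrm{Per}_1(\lambda)\subset\mathcal{M}$ is the set of all $(f)$ such that $f$ has a fixed point of multiplier $\lambda$. Let $\lambda_1,\dots,\lambda_{n+1}$ be the multipliers at the $n+1$ fixed points of $f$ (counted with multiplicity) and $\sigma_k$ their $k$-th elementary symmetric function. Then $\sigma_{n+1}=n^{n+1}X^{n-1}$, and $(X,\sigma_n)$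 is also a global holomorphic coordinate system identifying $\mathcal{M}$ with $\mathbb{C}^2$. Put $L_0=\{(f)\in\mathcal{M}: X(f)=0\}$. The extended moduli space $\widehat{\mathcal{M}}=\mathcal{M}\sqcup L_\infty$, where $L_\infty$ (the line at infinity) is a copy of $\mathbb{C}$ with coordinate $\hat\sigma_1$, is the complex manifold covered by two charts, each with image $\mathbb{C}^2$: the chart $\mathcal{M}$ with coordinates $(X,\sigma_n)$, and the chart $(\mathcal{M}\smallsetminus L_0)\cup L_\infty$ with coordinates $(\hat X,\hat\sigma_1)$, where $\hat X=0$ on $L_\infty$, and on $\mathcal{M}\smallsetminus L_0$ one has $\hat X=1/X$ and $\hat\sigma_1=\sigma_n/(n^{n+1}X^{n-1})$. The function $X$ extends to $\widehat{\mathcal{M}}\to\widehat{\mathbb{C}}$ with value $\infty$ on $L_\infty$, making $\widehat{\mathcal{M}}$ a holomorphic line bundle over $\widehat{\mathbb{C}}$. *)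

(* Defs.v *)
From HB Require Import structures.
From mathcomp Require Import all_boot all_order all_algebra.
From mathcomp Require Import complex.
From mathcomp Require Import all_classical all_reals topology normedtype derive.

Set Implicit Arguments.
Unset Strict Implicit.
Unset Printing Implicit Defensive.

Import Order.TTheory GRing.Theory Num.Theory.
Import numFieldNormedType.Exports.

Local Open Scope classical_set_scope.
Local Open Scope ring_scope.

(* The ascription to numClosedFieldType is what gives R[i] its topology and
   its structure of normed module over itself. *)
Definition Cplx (R : realType) : numClosedFieldType := R[i]%C.

Section BicriticalMaps.
Variable R : realType.
Local Notation C := (Cplx R).

(* The Riemann sphere; None is the point at infinity. *)
Definition sphere : Type := option C.

Definition sphere_inv (z : sphere) : sphere :=
  match z with
  | Some w => if w == 0 then None else Some w^-1
  | None => Some 0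
  end.

(* The local coordinate used at z0: z if z0 is finite, 1/z if z0 is infinity;
   its values outside the domain of the coordinate are irrelevant. *)
Definition coord_at (z0 z : sphere) : C :=
  odflt 0 (if z0 is Some _ then z else sphere_inv z).

Definition param_at (z0 : sphere) (w : C) : sphere :=
  if z0 is Some _ then Some w else sphere_inv (Some w).

Definition local_deriv (f : sphere -> sphere) (z0 : sphere) : C :=
  derive1 (fun w : C => coord_at (f z0) (f (param_at z0 w)) : C)
          (coord_at z0 z0).

Definition critical_points (f : sphere -> sphere) : set sphere :=
  [set z | local_deriv f z = 0].

(* The multiplier of f at z, when f z = z. *)
Definition multiplier (f : sphere -> sphere) (z : sphere) : C :=
  local_deriv f z.

(* The map z |-> p(z)/q(z) of the sphere, for p and q coprime. *)
Definition ratmap (p q : {poly C}) (z : sphere) : sphere :=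
  match z with
  | Some w => if q.[w] == 0 then None else Some (p.[w] / q.[w])
  | None => let m := (maxn (size p) (size q)).-1 in
            if q`_m == 0 then None else Some (p`_m / q`_m)
  end.

Definition rat_repr (n : nat) (f : sphere -> sphere) (p q : {poly C}) : Prop :=
  [/\ coprimep p q, (maxn (size p) (size q)).-1 = n & f = ratmap p q].

Definition bicritical (n : nat) (f : sphere -> sphere) : Prop :=
  (exists p q, rat_repr n f p q) /\
  exists z1 z2, z1 <> z2 /\ critical_points f = [set z1; z2].

Definition mobius (mu : sphere -> sphere) : Prop :=
  exists a b c d : C, a * d - b * c != 0 /\
    mu = ratmap (a *: 'X + b%:P) (c *: 'X + d%:P).

Definition mobius_conj (f g : sphere -> sphere) : Prop :=
  exists mu, mobius mu /\ mu \o f = g \o mu.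

(* Multiplicity of z as a fixed point of f = p/q of degree n, i.e. as a zero of
   the form of degree n + 1 whose dehomogenization is X q - p. *)
Definition fix_mult (n : nat) (p q : {poly C}) (z : sphere) : nat :=
  match z with
  | Some w => mup w ('X * q - p)
  | None => (n.+1 - (size ('X * q - p)%R).-1)%N
  end.

Definition fixed_points (n : nat) (f : sphere -> sphere)
    (l : n.+1.-tuple sphere) : Prop :=
  exists p q, rat_repr n f p q /\ forall z, count_mem z l = fix_mult n p q z.

Definition elem_sym (m k : nat) (t : 'I_m -> C) : C :=
  \sum_(A : {set 'I_m} | #|A| == k) \prod_(i in A) t i.

Definition normal_form (n : nat) (a b c d : C) : sphere -> sphere :=
  ratmap (a *: 'X^n + b%:P) (c *: 'X^n + d%:P).

Section Moduli.
Variable n : nat.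

Record moduli := Moduli {
  mclass : set (sphere -> sphere);
  mclassP : exists2 f, bicritical n f & mclass = [set g | mobius_conj f g]
}.

(* The invariants X and sigma_k take the same value on all the representatives
   of a class that can be used to compute them; xget selects this value. *)
Definition X_inv (m : moduli) : C :=
  xget 0 [set x | exists a b c d : C,
    [/\ a * d - b * c != 0, mclass m (normal_form n a b c d)
      & x = b * c / (a * d - b * c)]].

Definition sigma (k : nat) (m : moduli) : C :=
  xget 0 [set s | exists f (l : n.+1.-tuple sphere),
    [/\ mclass m f, fixed_points f l
      & s = elem_sym k (fun i => multiplier f (tnth l i))]].

Definition Per1 (lambda : C) : set moduli :=
  [set m | exists f z,
    [/\ mclass m f, f z = z & multiplier f z = lambda]].

(* The set underlying the extended moduli space; minf s is the point of the
   line at infinity at which the coordinate hat sigma_1 equals s. *)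
Inductive ext_moduli := mfin of moduli | minf of C.

Definition Linf : set ext_moduli := range minf.

Definition fin_dom : set ext_moduli := range mfin.

Definition fin_chart (p : ext_moduli) : C * C :=
  match p with
  | mfin m => (X_inv m, sigma n m)
  | minf _ => (0, 0) (* outside fin_dom *)
  end.

Definition inf_dom : set ext_moduli :=
  [set p | if p is mfin m then X_inv m <> 0 else True].

Definition inf_chart (p : ext_moduli) : C * C :=
  match p with
  | mfin m =>
      ((X_inv m)^-1, sigma n m / (n%:R ^+ n.+1 * X_inv m ^+ n.-1))
  | minf s => (0, s)
  end.

Definition X_ext (p : ext_moduli) : sphere :=
  if p is mfin m then Some (X_inv m) else None.

Definition chart_open (dom : set ext_moduli) (phi : ext_moduli -> C * C)
    (U : set ext_moduli) : Prop :=
  exists2 W : set (C * C), open W & U `&` dom = phi @^-1` W `&` dom.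

(* The topology for which the two chart domains are open and the two charts
   are homeomorphisms onto C^2. *)
Definition ext_open (U : set ext_moduli) : Prop :=
  chart_open fin_dom fin_chart U /\ chart_open inf_dom inf_chart U.

Lemma chart_openT dom phi : chart_open dom phi setT.
Proof. by exists setT; [exact: openT|rewrite preimage_setT]. Qed.

Lemma chart_openI dom phi : setI_closed (chart_open dom phi).
Proof.
move=> U V [A oA UA] [B oB VB]; exists (A `&` B); first exact: openI.
by rewrite preimage_setI setIIl UA VB -setIIl.
Qed.

Lemma chart_open_bigcup dom phi (I : Type) (F : I -> set ext_moduli) :
  (forall i, chart_open dom phi (F i)) ->
  chart_open dom phi (\bigcup_i F i).
Proof.
move=> oF.
have /choice[W WP] : forall i, exists W : set (C * C),
    open W /\ F i `&` dom = phi @^-1` W `&` dom.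
  by move=> i; have [W] := oF i; exists W.
exists (\bigcup_i W i); first by apply: bigcup_open => i _; exact: (WP i).1.
rewrite preimage_bigcup !setI_bigcupl.
by apply: eq_bigcupr => i _; exact: (WP i).2.
Qed.

Lemma ext_openT : ext_open setT.
Proof. by split; exact: chart_openT. Qed.

Lemma ext_openI : setI_closed ext_open.
Proof. by move=> U V [? ?] [? ?]; split; exact: chart_openI. Qed.

Lemma ext_open_bigcup (I : Type) (F : I -> set ext_moduli) :
  (forall i, ext_open (F i)) -> ext_open (\bigcup_i F i).
Proof.
by move=> oF; split; apply: chart_open_bigcup => i; case: (oF i).
Qed.

HB.instance Definition _ := gen_eqMixin ext_moduli.
HB.instance Definition _ := gen_choiceMixin ext_moduli.
HB.instance Definition _ :=
  isOpenTopological.Build ext_moduli ext_openT ext_openI ext_open_bigcup.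

End Moduli.

(* Polynomials in two variables (x, y): y is the outer variable. *)
Definition eval2 (P : {poly {poly C}}) (u : C * C) : C := P.[u.2%:P].[u.1].

Definition zero_locus (P : {poly {poly C}}) : set (C * C) :=
  [set u | eval2 P u = 0].

Definition affine_curve (Z : set (C * C)) : Prop :=
  exists P : {poly {poly C}},
    (forall c : C, P <> c%:P%:P) /\ Z = zero_locus P.

(* The disjunction says that the gradient of P does not vanish at u. *)
Definition smooth_zero_locus (Z : set (C * C)) : Prop :=
  exists P : {poly {poly C}}, Z = zero_locus P /\
    forall u, Z u -> eval2 (map_poly deriv P) u <> 0 \/ eval2 P^`() u <> 0.

(* The part of a curve in a chart may be empty (P = 1), as happens for the
   line at infinity in the finite chart. *)
Definition smooth_algebraic_curve (n : nat) (S : set (ext_moduli n)) : Prop :=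
  [/\ S !=set0,
      smooth_zero_locus (@fin_chart n @` (S `&` @fin_dom n))
    & smooth_zero_locus (@inf_chart n @` (S `&` @inf_dom n))].

Definition holomorphic (f : C -> C) : Prop := forall z : C, derivable f z 1.

(* Over the finite part of the base the fibre coordinate is sigma_n, and near
   infinity, where the base coordinate is w = 1/X, it is hat sigma_1. *)
Definition smooth_section (n : nat) (s : sphere -> ext_moduli n) : Prop :=
  [/\ forall x, X_ext (s x) = x,
      holomorphic (fun z => (fin_chart (s (Some z))).2)
    & holomorphic (fun w => (inf_chart (s (sphere_inv (Some w)))).2)].

End BicriticalMaps.

(* Main.v *)
(* The critical points can be moved to 0 and oo, which turns the map into
   z |-> (a z^n + b) / (c z^n + d); conjugacies between such normal forms
   preserve {0, oo}, so X is well defined, and X and Y together determine the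
   class. A computation with the power sums of the fixed points and of their
   inverses gives sigma_n = n^n (Y + X^(n-1) (2 X + 1 - n)).

   Suppose that x is a fixed point of multiplier n k <> 0 of a normal form, and put
   Q = c x^n / (c x^n + d) and Q' = b / (a x^n + b). Then Q + Q' = 1 - k and
   Q Q' = k X, and Y is, up to the factor 1/k, the symmetric expression
   (Q + k)^2 (X + Q')^(n-1) + (Q' + k)^2 (X + Q)^(n-1), hence a polynomial in
   X. It follows that sigma_n = S(X) for a polynomial S of degree at most n - 1
   whose coefficient of degree n - 1 is n^(n+1) (lambda + 1/lambda). As every
   value of X is realized by a map with such a fixed point, Per_1(lambda) is
   the graph of S. In the chart at infinity this graph becomes that of the
   reversed polynomial S^ = X^^(n-1) S(1/X^) / n^(n+1), and
   S^(0) = lambda + 1/lambda. *)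
Require Import Defs.
From mathcomp Require Import all_boot all_order all_algebra ring zify.
From mathcomp Require Import complex.
From mathcomp Require Import all_classical all_reals topology normedtype derive.
Set Implicit Arguments.
Unset Strict Implicit.
Unset Printing Implicit Defensive.
Import Order.TTheory GRing.Theory Num.Theory.
Import numFieldNormedType.Exports.
Local Open Scope classical_set_scope.
Local Open Scope ring_scope.

(** Bicriticality only says that the derivative vanishes at exactly two points, with no
    multiplicities. The Wronskian p' q - p q' has 2 n - 2 zeros on the sphere, each of order at most
    n - 1, so both critical points are totally ramified; then suitable combinations of p and q are
    n-th powers of the linear forms vanishing there, and these forms are the coordinates of the
    normal form.

    The quantities Q and Q' come from a normalization: when the fixed point is 1 and a + b = c + d =
    1, one has Q = c, Q' = b, k = a d - b c, hence a = Q + k and d = Q' + k. Since k (X + Q') = a b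
    and k (X + Q) = c d, the two terms of Y are exchanged by Q <-> Q', and Q, Q' are the roots of a
    quadratic whose coefficients are affine in X.

    The bound n - 1 on the degree of S rests on a cancellation: Y contributes -2 X^n and the other
    summand of sigma_n contributes 2 X^n. With a term of degree n the curve would not meet the line
    at infinity. *)

(** * Points and rational maps of the sphere in homogeneous coordinates *)

Section HomogeneousCoordinates.
Variable F : numClosedFieldType.
Implicit Types (x y k w a b c d : F) (p q : {poly F}) (z : option F).

(* The notions of Defs over an arbitrary numClosedFieldType, to which they are
   convertible at Cplx R: there, unification would unfold the construction of
   the complex numbers. *)
Definition gsphere_inv z : option F :=
  match z with
  | Some w => if w == 0 then None else Some w^-1
  | None => Some 0
  end.

Definition gcoord_at z0 z : F :=
  odflt 0 (if z0 is Some _ then z else gsphere_inv z).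

Definition gparam_at z0 w : option F :=
  if z0 is Some _ then Some w else gsphere_inv (Some w).

Definition gratmap p q z : option F :=
  match z with
  | Some w => if q.[w] == 0 then None else Some (p.[w] / q.[w])
  | None => let m := (maxn (size p) (size q)).-1 in
            if q`_m == 0 then None else Some (p`_m / q`_m)
  end.

(** The point [x : y] of the projective line. Infinity is then a point like any other, and
    equalities of maps become polynomial identities. The pair (0, 0) falls on [None], hence the
    hypotheses [nz2]. *)
Definition hpt x y : option F := if y == 0 then None else Some (x / y).

Definition nz2 x y := (x != 0) || (y != 0).

Lemma hpt_scale k x y : k != 0 -> hpt (k * x) (k * y) = hpt x y.
Proof.
move=> k0; rewrite /hpt mulf_eq0 (negPf k0) /=; case: eqP => // _.
by congr Some; rewrite -mulf_div divff // mul1r.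
Qed.

Lemma hpt_cross x y x' y' : hpt x y = hpt x' y' -> x * y' = x' * y.
Proof.
rewrite /hpt; case: eqP => [->|/eqP y0]; case: eqP => [->|/eqP y'0] //.
  by rewrite !mulr0.
by move=> [] /eqP; rewrite eqr_div // => /eqP.
Qed.

Lemma hptP z : exists x y, nz2 x y /\ z = hpt x y.
Proof.
case: z => [w|]; [exists w, 1|exists 1, 0].
  by rewrite /nz2 oner_eq0 orbT /hpt oner_eq0 divr1.
by rewrite /nz2 oner_eq0 /hpt eqxx.
Qed.

Lemma hptS w : Some w = hpt w 1.
Proof. by rewrite /hpt oner_eq0 divr1. Qed.

Lemma hptN : None = hpt 1 0.
Proof. by rewrite /hpt eqxx. Qed.

Lemma sphere_inv_hpt x y : nz2 x y -> gsphere_inv (hpt x y) = hpt y x.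
Proof.
rewrite /hpt /nz2 /=; have [->|y0] := eqVneq y 0 => /=.
  by rewrite orbF => /negPf ->; rewrite mul0r.
rewrite mulf_eq0 invr_eq0 (negPf y0) orbF => _.
by case: eqP => // _; rewrite invf_div.
Qed.

Lemma coord_hpt z0 x y :
  gcoord_at z0 (hpt x y) = if z0 is Some _ then x / y else y / x.
Proof.
rewrite /gcoord_at /hpt; case: z0 => [w|]; have [->|y0] := eqVneq y 0 => //=.
- by rewrite invr0 mulr0.
- by rewrite mul0r.
rewrite mulf_eq0 invr_eq0 (negPf y0) orbF.
by case: eqP => [->|_] /=; rewrite ?invr0 ?mulr0 ?invf_div.
Qed.

Lemma param_hpt z0 w :
  gparam_at z0 w = if z0 is Some _ then hpt w 1 else hpt 1 w.
Proof.
case: z0 => [u|]; first by rewrite -hptS.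
by rewrite /gparam_at hptS sphere_inv_hpt // /nz2 oner_eq0 orbT.
Qed.

(** For p of degree at most n, the form of degree n that dehomogenizes to p. *)
Definition homog n p x y : F := if y == 0 then p`_n * x ^+ n else y ^+ n * p.[x / y].

Lemma homogD n p q x y : homog n (p + q) x y = homog n p x y + homog n q x y.
Proof. by rewrite /homog; case: eqP; rewrite ?coefD ?hornerD ?mulrDl ?mulrDr. Qed.

Lemma homogZ n k p x y : homog n (k *: p) x y = k * homog n p x y.
Proof.
by rewrite /homog; case: eqP; rewrite ?coefZ ?hornerZ ?mulrA // [k * _]mulrC.
Qed.

Lemma homogS n p w : homog n p w 1 = p.[w].
Proof. by rewrite /homog oner_eq0 expr1n mul1r divr1. Qed.

Lemma homogN n p : homog n p 1 0 = p`_n.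
Proof. by rewrite /homog eqxx expr1n mulr1. Qed.

Lemma homog_XsubCn n u x y : homog n (('X - u%:P) ^+ n) x y = (x - u * y) ^+ n.
Proof.
rewrite /homog; have [->|y0] := eqVneq y 0.
  rewrite mulr0 subr0; have := monicP (monic_exp n (monicXsubC u)).
  by rewrite lead_coefE size_exp_XsubC /= => ->; rewrite mul1r.
rewrite horner_exp hornerXsubC -exprMn; congr (_ ^+ _).
by rewrite mulrBr mulrCA divff // mulr1 mulrC.
Qed.

Lemma homog_Xn n x y : (0 < n)%N -> homog n 'X^n x y = x ^+ n.
Proof.
by move=> n0; have := homog_XsubCn n 0 x y; rewrite subr0 mul0r subr0.
Qed.

Lemma homog_C n u x y : (0 < n)%N -> homog n u%:P x y = u * y ^+ n.
Proof.
rewrite /homog coefC hornerC; case: n => // n _ /=.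
by case: eqP => [->|_]; rewrite ?expr0n /= ?mulr0 ?mul0r // mulrC.
Qed.

Definition rdeg p q := (maxn (size p) (size q)).-1.

Lemma ratmap_hpt p q x y : nz2 x y ->
  gratmap p q (hpt x y) = hpt (homog (rdeg p q) p x y) (homog (rdeg p q) q x y).
Proof.
have [->|y0] := eqVneq y 0 => xy.
  have x0 : x != 0 by move: xy; rewrite /nz2 eqxx orbF.
  rewrite [in LHS]/hpt eqxx /= /homog eqxx -/(rdeg p q).
  by rewrite ![_ * x ^+ _]mulrC hpt_scale ?expf_neq0.
by rewrite [in LHS]/hpt (negPf y0) /= /homog (negPf y0) hpt_scale ?expf_neq0.
Qed.

Lemma coprime_nz2 p q w : coprimep p q -> nz2 p.[w] q.[w].
Proof.
move=> cpq; rewrite /nz2; have [e|//] := eqVneq p.[w] 0.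
by apply: coprimep_root cpq _; apply/eqP.
Qed.

Lemma size_rdegl p q : (size p <= (rdeg p q).+1)%N.
Proof. by rewrite /rdeg (leq_trans (leq_maxl _ (size q))) // leqSpred. Qed.

Lemma size_rdegr p q : (size q <= (rdeg p q).+1)%N.
Proof. by rewrite /rdeg (leq_trans (leq_maxr (size p) _)) // leqSpred. Qed.

(** One of the two polynomials attains the degree, since coprimality forbids that both vanish. Thus
    the two forms have no common zero at infinity. *)
Lemma lead_nz2 p q : coprimep p q -> nz2 p`_(rdeg p q) q`_(rdeg p q).
Proof.
move=> cpq; rewrite /nz2 /rdeg.
have pq0 : (p != 0) || (q != 0).
  have [p0|//] := eqVneq p 0; have [q0|//] := eqVneq q 0.
  by move: cpq; rewrite p0 q0 coprimep0 => /eqp_size; rewrite size_poly0 size_poly1.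
have [le_pq|lt_qp] := leqP (size p) (size q).
  have q0 : q != 0.
    apply: contraLR pq0 => /negPn/eqP q0; rewrite q0 eqxx orbF negbK.
    by move: le_pq; rewrite q0 size_poly0 leqn0 size_poly_eq0.
  by rewrite -lead_coefE lead_coef_eq0 q0 orbT.
by rewrite -lead_coefE lead_coef_eq0 -size_poly_gt0 (leq_ltn_trans _ lt_qp).
Qed.

Lemma homog_nz2 p q x y : coprimep p q -> nz2 x y ->
  nz2 (homog (rdeg p q) p x y) (homog (rdeg p q) q x y).
Proof.
move=> cpq; rewrite /homog; have [->|y0] := eqVneq y 0 => xy.
  have x0 : x != 0 by move: xy; rewrite /nz2 eqxx orbF.
  by rewrite /nz2 !mulf_eq0 !expf_eq0 (negPf x0) !andbF !orbF; exact: lead_nz2.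
rewrite /nz2 !mulf_eq0 !expf_eq0 (negPf y0) !andbF /=.
exact: (coprime_nz2 _ cpq).
Qed.

(** The reciprocal polynomial w^n p(1/w), that is, p seen from the coordinate at infinity. *)
Definition rv n p := \poly_(i < n.+1) p`_(n - i).

Lemma horner_rv n p w : (size p <= n.+1)%N -> (rv n p).[w] = homog n p 1 w.
Proof.
move=> sp; rewrite /rv /homog horner_poly; have [->|w0] := eqVneq w 0.
  rewrite expr1n mulr1 big_ord_recl /= subn0 expr0 mulr1 big1 ?addr0 // => i _.
  by rewrite expr0n /= mulr0.
rewrite (horner_coef_wide _ sp) mulr_sumr (reindex_inj rev_ord_inj) /=.
apply: eq_bigr => i _; have le_in : (i <= n)%N by rewrite -ltnS.
rewrite subSS subKn // mulrCA; congr (_ * _).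
by rewrite expr_div_n expr1n mul1r expfB_cond // (negPf w0).
Qed.

Lemma coef_rv n p i : (i <= n)%N -> (rv n p)`_i = p`_(n - i).
Proof. by move=> le_in; rewrite coef_poly ltnS le_in. Qed.

(* Numerator and denominator of the map p/q read in the coordinate used at z. *)
Definition chart_poly (z : option F) n p := if z is Some _ then p else rv n p.

Lemma ratmap_param p q z w :
  gratmap p q (gparam_at z w) = hpt (chart_poly z (rdeg p q) p).[w]
                                  (chart_poly z (rdeg p q) q).[w].
Proof.
rewrite param_hpt; case: z => [u|] /=.
  by rewrite ratmap_hpt ?homogS // /nz2 oner_eq0 orbT.
rewrite ratmap_hpt ?horner_rv ?size_rdegl ?size_rdegr //.
by rewrite /nz2 oner_eq0.
Qed.

Lemma chart_poly_nz2 p q z w : coprimep p q ->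
  nz2 (chart_poly z (rdeg p q) p).[w] (chart_poly z (rdeg p q) q).[w].
Proof.
move=> cpq; case: z => [u|] /=; first exact: coprime_nz2.
rewrite !horner_rv ?size_rdegl ?size_rdegr //.
by apply: homog_nz2 => //; rewrite /nz2 oner_eq0.
Qed.

Lemma param_coord z : gparam_at z (gcoord_at z z) = z.
Proof.
rewrite param_hpt /gcoord_at; case: z => [u|] /=; first by rewrite -hptS.
by rewrite -hptN.
Qed.

End HomogeneousCoordinates.

(** * Derivatives in the local coordinates of the sphere *)

Section LocalDerivative.
Variable F : numClosedFieldType.
Implicit Types (x y k w a b c d : F) (p q A B : {poly F}) (z : option F).
Implicit Types f g : option F -> option F.

Definition glocal_deriv f z0 : F :=
  derive1 (fun w : F => gcoord_at (f z0) (f (gparam_at z0 w)) : F)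
          (gcoord_at z0 z0).

Lemma is_derive_horner p w : is_derive w (1 : F) (fun x => p.[x] : F) p^`().[w].
Proof.
elim/poly_ind: p => [|p k ih].
  rewrite deriv0 horner0 (_ : (fun x => _) = cst 0).
    exact: is_derive_cst.
  by apply/funext => x; rewrite horner0.
rewrite (_ : (fun x => _) = (fun x => p.[x] : F) * id + cst k); last first.
  by apply/funext => x; rewrite /= !hornerE.
apply: is_derive_eq.
by rewrite derivD derivC addr0 derivM derivX !hornerE /GRing.scale /=; ring.
Qed.

Lemma continuous_horner_poly p : continuous (fun x => p.[x] : F).
Proof.
move=> w; have [dp _] := is_derive_horner p w.
exact/differentiable_continuous/derivable1_diffP.
Qed.

Lemma is_derive_quot A B w : B.[w] != 0 ->
  is_derive w (1 : F) (fun x => A.[x] / B.[x] : F)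
    ((A^`().[w] * B.[w] - A.[w] * B^`().[w]) / B.[w] ^+ 2).
Proof.
move=> Bw.
have dA := is_derive_horner A w; have dB := is_derive_horner B w.
have dV : is_derive w (1 : F) (fun x => (B.[x])^-1 : F) (- (B.[w]) ^- 2 *: B^`().[w]).
  apply: DeriveDef; first by apply: derivableV => //; case: dB.
  by rewrite deriveV //; case: dB => // _ ->.
have := is_deriveM dA dV; rewrite (_ : _ * _ = (fun x => A.[x] / B.[x] : F)) //.
move=> h; apply: is_derive_eq h _.
by rewrite /GRing.scale /=; field.
Qed.

Lemma is_derive1_comp (f g : F -> F) w df dg :
  is_derive w (1 : F) f df -> is_derive (f w) (1 : F) g dg ->
  is_derive w (1 : F) (g \o f) (dg * df).
Proof.
move=> [df1 dfE] [dg1 dgE].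
have /derivable1_diffP df2 := df1; have /derivable1_diffP dg2 := dg1.
have dgf : differentiable (g \o f) w by apply: differentiable_comp.
apply: DeriveDef; first exact/derivable1_diffP.
rewrite deriveE // diff_comp //= -[X in 'd g _ X]deriveE // dfE.
rewrite -[X in 'd g _ X]mulr1 [LHS]linearZ -deriveE // dgE.
by rewrite /GRing.scale /= mulrC.
Qed.

Lemma near_neq0 p w : p.[w] != 0 -> \forall x \near w, p.[x] != 0.
Proof.
by move=> pw; exact: (cvgr_neq0 _ (@continuous_horner_poly p w) pw).
Qed.

Definition local_expr f z w := gcoord_at (f z) (f (gparam_at z w)).

(* The coordinates have junk values outside their domains; the second conjunct
   says that none of them is met near z. *)
Definition sph_derive f z df :=
  is_derive (gcoord_at z z) (1 : F) (local_expr f z : F -> F) df /\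
  (\forall w \near gcoord_at z z,
     f (gparam_at z w) = gparam_at (f z) (local_expr f z w)).

Lemma sph_deriveE f z df : sph_derive f z df -> glocal_deriv f z = df.
Proof. by move=> [[_ <-] _]; rewrite /glocal_deriv derive1E. Qed.

(** Because no default value of the coordinates is met near the points involved, the coordinate
    expression of the composite is locally the composite of the coordinate expressions, and the
    ordinary chain rule applies. *)
Lemma sph_derive_comp f g z df dg :
  sph_derive f z df -> sph_derive g (f z) dg -> sph_derive (g \o f) z (dg * df).
Proof.
move=> [df1 nf] [dg1 ng].
have e : local_expr f z (gcoord_at z z) = gcoord_at (f z) (f z).
  by rewrite /local_expr param_coord.
have cf : {for gcoord_at z z, continuous (local_expr f z : F -> F)}.
  by case: df1 => df1 _; exact/differentiable_continuous/derivable1_diffP.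
have nfg : \forall w \near gcoord_at z z, local_expr (g \o f) z w =
    local_expr g (f z) (local_expr f z w).
  by move: nf; apply: filter_app; near=> w => e1; rewrite {1}/local_expr /= e1.
split.
  apply: (near_eq_is_derive (f := local_expr g (f z) \o local_expr f z : F -> F)).
    by move: nfg; apply: filter_app; near=> w => ->.
  by apply: is_derive1_comp => //; rewrite e.
have ng' : \forall w \near gcoord_at z z, g (gparam_at (f z) (local_expr f z w)) =
     gparam_at (g (f z)) (local_expr g (f z) (local_expr f z w)).
  by rewrite -e in ng; exact: (cf _ ng).
by move: nf nfg ng'; apply: filter_app3; near=> w => /= e1 -> <-; rewrite e1.
Unshelve. all: by end_near. Qed.

(** The Wronskian, numerator of the derivative of A / B. *)
Definition wron A B w := A^`().[w] * B.[w] - A.[w] * B^`().[w].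

(** At a pole the target coordinate is the reciprocal, so that B / A is differentiated instead; this
    explains the sign and the denominator A^2. *)
Lemma sph_derive_ratmap p q z : coprimep p q ->
  let n := rdeg p q in
  let A := chart_poly z n p in let B := chart_poly z n q in
  let w := gcoord_at z z in
  sph_derive (gratmap p q) z
    (if gratmap p q z is Some _ then wron A B w / B.[w] ^+ 2
     else - wron A B w / A.[w] ^+ 2).
Proof.
move=> cpq n A B w.
have eA x : gratmap p q (gparam_at z x) = hpt A.[x] B.[x] by exact: ratmap_param.
have AB : nz2 A.[w] B.[w] by exact: chart_poly_nz2.
have ez : gratmap p q z = hpt A.[w] B.[w] by rewrite -eA param_coord.
rewrite /sph_derive /local_expr; under eq_fun do rewrite eA.
have [B0|B0] := eqVneq B.[w] 0.
  have A0 : A.[w] != 0 by move: AB; rewrite /nz2 B0 eqxx orbF.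
  rewrite ez /hpt B0 eqxx -/(hpt _ _); split.
    under eq_fun do rewrite coord_hpt.
    have h := is_derive_quot B A0; apply: is_derive_eq h _.
    by congr (_ / _); rewrite /wron; ring.
  have := near_neq0 A0; apply: filter_app; near=> x => Ax.
  by rewrite eA coord_hpt param_hpt -[RHS](hpt_scale _ _ Ax) mulr1 mulrCA divff ?mulr1.
rewrite ez /hpt (negPf B0) -/(hpt _ _); split.
  under eq_fun do rewrite -/(hpt _ _) coord_hpt.
  exact: is_derive_quot.
have := near_neq0 B0; apply: filter_app; near=> x => Bx.
by rewrite eA coord_hpt param_hpt -[RHS](hpt_scale _ _ Bx) mulr1 mulrCA divff ?mulr1.
Unshelve. all: by end_near. Qed.

End LocalDerivative.

(** * Möbius maps, normal forms, and invariance of multipliers *)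

Section Mobius.
Variable F : numClosedFieldType.
Implicit Types (x y k w a b c d : F) (p q : {poly F}) (z : option F).
Implicit Types (f g mu : option F -> option F).

Definition gnf n a b c d := gratmap (a *: 'X^n + b%:P) (c *: 'X^n + d%:P).

Definition gmob a b c d := gratmap (a *: 'X + b%:P) (c *: 'X + d%:P).

Definition gmobius mu := exists a b c d, a * d - b * c != 0 /\ mu = gmob a b c d.

Definition gconj f g := exists mu, gmobius mu /\ mu \o f = g \o mu.

Lemma size_nf n a b : (size (a *: 'X^n + b%:P)%R <= n.+1)%N.
Proof.
rewrite (leq_trans (size_polyD _ _)) // geq_max (leq_trans (size_scale_leq _ _)) ?size_polyXn //.
by rewrite (leq_trans (size_polyC_leq1 _)).
Qed.

Lemma coef_nf n a b : (0 < n)%N -> (a *: 'X^n + b%:P)`_n = a.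
Proof.
by case: n => // n _; rewrite coefD coefZ coefXn eqxx mulr1 coefC addr0.
Qed.

Lemma det_nz2 a b c d : a * d - b * c != 0 -> nz2 a c.
Proof.
apply: contraNT; rewrite /nz2 negb_or !negbK => /andP[/eqP-> /eqP->].
by rewrite mul0r mulr0 subr0.
Qed.

Lemma rdeg_nf n a b c d : (0 < n)%N -> nz2 a c ->
  rdeg (a *: 'X^n + b%:P) (c *: 'X^n + d%:P) = n.
Proof.
move=> n0 ac; rewrite /rdeg.
suff -> : maxn (size (a *: 'X^n + b%:P)%R) (size (c *: 'X^n + d%:P)%R) = n.+1 by [].
apply/eqP; rewrite eqn_leq geq_max !size_nf /= leq_max.
have gt_size (u v : F) : u != 0 -> (n < size (u *: 'X^n + v%:P)%R)%N.
  move=> u0; rewrite ltnNge; apply: contra u0 => /leq_sizeP /(_ n (leqnn _)).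
  by rewrite coef_nf // => ->.
by case/orP: ac => /gt_size ->; rewrite ?orbT.
Qed.

Lemma coprime_nf n a b c d : a * d - b * c != 0 ->
  coprimep (a *: 'X^n + b%:P) (c *: 'X^n + d%:P).
Proof.
move=> D0; apply/Bezout_coprimepP.
(* The combination -c p + a q eliminates X^n and leaves the determinant. *)
exists ((- c)%:P, a%:P) => /=.
rewrite (_ : _ + _ = (a * d - b * c)%:P) ?polyC_eqp1 //.
by rewrite -!mul_polyC polyCB !polyCM polyCN; ring.
Qed.

Lemma homog_nf n a b x y : (0 < n)%N ->
  homog n (a *: 'X^n + b%:P) x y = a * x ^+ n + b * y ^+ n.
Proof. by move=> n0; rewrite homogD homogZ homog_Xn // homog_C. Qed.

Lemma nf_hpt n a b c d x y : (0 < n)%N -> nz2 a c -> nz2 x y ->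
  gnf n a b c d (hpt x y) =
  hpt (a * x ^+ n + b * y ^+ n) (c * x ^+ n + d * y ^+ n).
Proof. by move=> n0 ac xy; rewrite /gnf ratmap_hpt // rdeg_nf // !homog_nf. Qed.

Lemma mob_hpt a b c d x y : nz2 a c -> nz2 x y ->
  gmob a b c d (hpt x y) = hpt (a * x + b * y) (c * x + d * y).
Proof. by move=> ac xy; rewrite [LHS](@nf_hpt 1). Qed.

Lemma nz2_lin a b c d x y : a * d - b * c != 0 -> nz2 x y ->
  nz2 (a * x + b * y) (c * x + d * y).
Proof.
move=> D0; apply: contraTT; rewrite /nz2 negb_or !negbK => /andP[/eqP e1 /eqP e2].
have ex : (a * d - b * c) * x = d * (a * x + b * y) - b * (c * x + d * y) by ring.
have ey : (a * d - b * c) * y = a * (c * x + d * y) - c * (a * x + b * y) by ring.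
move: ex ey; rewrite e1 e2 !mulr0 subrr => /eqP + /eqP.
by rewrite !mulf_eq0 (negPf D0) /= => -> ->.
Qed.

Lemma mob_comp a b c d a' b' c' d' :
  a * d - b * c != 0 -> a' * d' - b' * c' != 0 ->
  gmob a b c d \o gmob a' b' c' d' =
  gmob (a * a' + b * c') (a * b' + b * d') (c * a' + d * c') (c * b' + d * d').
Proof.
move=> D0 D0'; have ac := det_nz2 D0; have ac' := det_nz2 D0'.
apply/funext => z; have [x [y [xy ->]]] := hptP z.
rewrite /= !mob_hpt //.
- by congr hpt; ring.
- exact: nz2_lin D0 ac'.
- exact: nz2_lin D0' xy.
Qed.

Lemma mob_id k : k != 0 -> gmob k 0 0 k = id.
Proof.
move=> k0; apply/funext => z; have [x [y [xy ->]]] := hptP z.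
by rewrite mob_hpt /nz2 ?k0 // !mul0r addr0 add0r hpt_scale.
Qed.

Lemma gmobius_comp mu nu : gmobius mu -> gmobius nu -> gmobius (mu \o nu).
Proof.
move=> [a [b [c [d [D0 ->]]]]] [a' [b' [c' [d' [D0' ->]]]]].
rewrite mob_comp //; do 4!eexists; split; last by [].
rewrite (_ : _ - _ = (a * d - b * c) * (a' * d' - b' * c')); last by ring.
by rewrite mulf_neq0.
Qed.

Lemma gmobius_inv mu : gmobius mu ->
  exists nu, [/\ gmobius nu, mu \o nu = id & nu \o mu = id].
Proof.
move=> [a [b [c [d [D0 ->]]]]]; exists (gmob d (- b) (- c) a).
have D0' : d * a - (- b) * (- c) != 0 by rewrite mulrNN [d * a]mulrC.
split; first by exists d, (- b), (- c), a.
  rewrite mob_comp // -[RHS](mob_id D0); congr gmob; ring.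
rewrite mob_comp // -[RHS](mob_id D0); congr gmob; ring.
Qed.

Lemma gmobius_inj mu : gmobius mu -> injective mu.
Proof.
move=> /gmobius_inv[nu [_ _ e]] x y exy.
by rewrite -[x]/(id x) -[y]/(id y) -e /= exy.
Qed.

Lemma gconj_refl f : gconj f f.
Proof.
exists id; split => //; rewrite -(mob_id (oner_neq0 F)).
by exists 1, 0, 0, 1; rewrite mulr1 mulr0 subr0 oner_neq0.
Qed.

Lemma gconj_sym f g : gconj f g -> gconj g f.
Proof.
move=> [mu [mmu e]]; have [nu [mnu e1 e2]] := gmobius_inv mmu.
exists nu; split => //.
have -> : nu \o g = nu \o (g \o mu) \o nu by rewrite -compA -compA e1.
by rewrite -e compA e2.
Qed.

Lemma gconj_trans f g h : gconj f g -> gconj g h -> gconj f h.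
Proof.
move=> [mu [mmu e]] [nu [mnu e']]; exists (nu \o mu).
by split; [exact: gmobius_comp|rewrite -compA e compA e' compA].
Qed.

Lemma rv_nf n a b : (0 < n)%N -> rv n (a *: 'X^n + b%:P) = b *: 'X^n + a%:P.
Proof.
move=> n0; apply/polyP => i; have [le_in|lt_ni] := leqP i n.
  rewrite coef_rv // !coefD !coefZ !coefXn !coefC.
  have [->|i0] := posnP i.
    by rewrite subn0 eqxx [in X in _ + X]eqn0Ngt n0 [(0 == n)%N]eq_sym eqn0Ngt n0 !mulr1 mulr0 addr0 add0r.
  have -> : (n - i == n)%N = false by apply/eqP; lia.
  have -> : (n - i == 0)%N = (i == n) by apply/eqP/eqP; lia.
  rewrite mulr0 add0r addr0.
  by case: eqP; rewrite ?mulr1 ?mulr0.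
rewrite nth_default ?(leq_trans (size_poly _ _)) //.
by rewrite nth_default // (leq_trans (size_nf _ _ _)).
Qed.

Lemma wron_nf n a b c d w :
  wron (a *: 'X^n + b%:P) (c *: 'X^n + d%:P) w = (a * d - b * c) * (n%:R * w ^+ n.-1).
Proof.
rewrite /wron !derivD !derivC !derivZ derivXn !hornerE /= hornerMn hornerXn.
by rewrite -[_ *+ n]mulr_natl; ring.
Qed.

Lemma wron_chart_nf n a b c d z w : (0 < n)%N ->
  wron (chart_poly z n (a *: 'X^n + b%:P)) (chart_poly z n (c *: 'X^n + d%:P)) w =
  (if z is Some _ then a * d - b * c else b * c - a * d) * (n%:R * w ^+ n.-1).
Proof. by move=> n0; case: z => [u|] /=; rewrite ?rv_nf // wron_nf. Qed.

(** Both cases of [sph_derive_ratmap] have the Wronskian as numerator up to sign, so criticality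
    does not depend on whether the value is finite. *)
Lemma local_deriv_eq0 p q z : coprimep p q ->
  let n := rdeg p q in
  (glocal_deriv (gratmap p q) z == 0) =
  (wron (chart_poly z n p) (chart_poly z n q) (gcoord_at z z) == 0).
Proof.
move=> cpq n; rewrite (sph_deriveE (sph_derive_ratmap z cpq)) -/n.
set w := gcoord_at z z.
have := chart_poly_nz2 z w cpq; rewrite -/n.
have -> : gratmap p q z = hpt (chart_poly z n p).[w] (chart_poly z n q).[w].
  by rewrite -ratmap_param param_coord.
have [B0|B0] := eqVneq (chart_poly z n q).[w] 0 => AB.
  have A0 : (chart_poly z n p).[w] != 0 by move: AB; rewrite /nz2 B0 eqxx orbF.
  by rewrite /hpt B0 eqxx mulf_eq0 invr_eq0 expf_eq0 (negPf A0) andbF orbF oppr_eq0.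
by rewrite /hpt (negPf B0) mulf_eq0 invr_eq0 expf_eq0 (negPf B0) andbF orbF.
Qed.

Lemma local_deriv_nf_eq0 n a b c d z : (1 < n)%N -> a * d - b * c != 0 ->
  (glocal_deriv (gnf n a b c d) z == 0) = (z == Some 0) || (z == None).
Proof.
move=> n1 D0; have n0 := ltnW n1; rewrite local_deriv_eq0; last exact: coprime_nf.
rewrite rdeg_nf //; last exact: det_nz2 D0.
rewrite wron_chart_nf // !mulf_eq0 expf_eq0 pnatr_eq0 -(subnKC n1) /=.
case: z => [w|] /=; first by rewrite (negPf D0) orbF.
have -> : gcoord_at (@None F) None = 0 by [].
by rewrite !eqxx orbT.
Qed.

Lemma local_deriv_mob a b c d z : a * d - b * c != 0 ->
  glocal_deriv (gmob a b c d) z != 0.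
Proof.
move=> D0; have cpq := @coprime_nf 1 _ _ _ _ D0.
rewrite [glocal_deriv _ _ == 0](local_deriv_eq0 z cpq) (@rdeg_nf 1) //.
  rewrite (@wron_chart_nf 1) // expr0 !mulr1.
  by case: z => [_|] //; rewrite -opprB oppr_eq0.
exact: det_nz2 D0.
Qed.

(** Differentiate mu o f = g o mu at the fixed point and cancel the nonzero derivative of mu.
    Nothing is assumed on f itself: its differentiability comes from writing it as nu o g o mu, with
    nu the inverse of mu. *)
Lemma multiplier_conj f p q mu z : coprimep p q ->
  gmobius mu -> mu \o f = gratmap p q \o mu -> f z = z ->
  glocal_deriv (gratmap p q) (mu z) = glocal_deriv f z.
Proof.
move=> cpq mmu e fz; have [nu [mnu e1 e2]] := gmobius_inv mmu.
have dmob mu1 z1 : gmobius mu1 -> sph_derive mu1 z1 (glocal_deriv mu1 z1).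
  move=> [a [b [c [d [D0 ->]]]]].
  have d1 := sph_derive_ratmap z1 (@coprime_nf 1 _ _ _ _ D0).
  by rewrite (sph_deriveE d1).
have dN : sph_derive (gratmap p q) (mu z) (glocal_deriv (gratmap p q) (mu z)).
  by have d1 := sph_derive_ratmap (mu z) cpq; rewrite (sph_deriveE d1).
have dmu := dmob mu z mmu; have d2 := sph_derive_comp dmu dN.
have fE : f = nu \o (gratmap p q \o mu) by rewrite -e compA e2.
have df : sph_derive f z (glocal_deriv f z).
  have d1 := sph_derive_comp d2 (dmob nu _ mnu).
  by rewrite -fE in d1; rewrite (sph_deriveE d1).
have dmu' : sph_derive mu (f z) (glocal_deriv mu z) by rewrite fz.
have d1 := sph_derive_comp df dmu'.
have muz : glocal_deriv mu z != 0.
  by case: mmu => a [b [c [d [D0 ->]]]]; exact: local_deriv_mob.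
move: (sph_deriveE d1) (sph_deriveE d2); rewrite e => -> /esym.
by rewrite mulrC => /(mulfI muz).
Qed.

End Mobius.

(** * Ramification of a rational map and reduction to normal form *)

Section NormalForm.
Variable F : numClosedFieldType.
Implicit Types (x y s t e u w : F) (p q r A B : {poly F}) (z : option F).

Definition wronp A B := A^`() * B - A * B^`().

Lemma horner_wronp A B w : (wronp A B).[w] = wron A B w.
Proof. by rewrite /wronp /wron !hornerE. Qed.

Lemma mup_neq0_scale e u A : e != 0 -> mup u (e *: A) = mup u A.
Proof. by move=> e0; rewrite -mul_polyC mupMr // rootC. Qed.

Lemma wronp_subl s t A B : wronp (s *: A - t *: B) B = s *: wronp A B.
Proof. by rewrite /wronp derivB !derivZ -!mul_polyC; ring. Qed.

(** If r = r1 (X - u)^(m+1) with r1(u) nonzero, the Wronskian is g (X - u)^m with g(u) = (m + 1)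
    r1(u) B(u), which is nonzero in characteristic 0. *)
Lemma mup_wronp r B u : r != 0 -> root r u -> B.[u] != 0 ->
  wronp r B != 0 /\ mup u (wronp r B) = (mup u r).-1.
Proof.
move=> r0 ru Bu; have [m [r1 r1u rE]] := multiplicity_XsubC r u.
rewrite r0 /= in r1u.
case: m rE => [|m] rE; first by move: ru; rewrite rE mulr1 (negPf r1u).
have -> : mup u r = m.+1 by rewrite rE mupMr // mup_XsubCX eqxx.
pose g := m.+1%:R *: (r1 * B) + ('X - u%:P) * wronp r1 B.
have gu : ~~ root g u.
  by rewrite /root /g !hornerE subrr mul0r addr0 !mulf_neq0 // pnatr_eq0.
have -> : wronp r B = g * ('X - u%:P) ^+ m.
  rewrite /g /wronp rE derivM deriv_exp derivXsubC mul1r exprS scaler_nat.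
  rewrite -[('X - u%:P) ^+ m *+ _]mulr_natl -[(r1 * B) *+ _]mulr_natl.
  move: (m.+1%:R : {poly F}) (('X - u%:P) ^+ m) => K E; ring.
split; last by rewrite mupMr // mup_XsubCX eqxx.
rewrite mulf_neq0 ?expf_neq0 ?polyXsubC_eq0 //.
by apply: contraNneq gu => ->; rewrite root0.
Qed.

Lemma mup_lt_size r u : r != 0 -> (mup u r < size r)%N.
Proof.
move=> r0; have := mup_geq u (mup u r) r0; rewrite leqnn => /esym/(dvdp_leq r0).
by rewrite size_exp_XsubC.
Qed.

Lemma mup_max r u n : r != 0 -> (size r <= n.+1)%N -> mup u r = n ->
  exists2 e, e != 0 & r = e *: ('X - u%:P) ^+ n.
Proof.
move=> r0 sr mr; have := mup_geq u n r0; rewrite mr leqnn => /esym/dvdpP[h hE].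
have h0 : h != 0 by apply: contraNneq r0 => h0; rewrite hE h0 mul0r.
have sh : (size h <= 1)%N.
  by move: sr; rewrite hE size_Mmonic ?monic_exp ?monicXsubC // size_exp_XsubC addnS /= -addn1 addnC leq_add2l.
move: hE; rewrite (size1_polyC sh) mul_polyC => ->; exists h`_0 => //.
by rewrite -polyC_eq0 -size1_polyC.
Qed.

(** Replacing A by the combination r of A and B that vanishes at u only multiplies the Wronskian by
    a constant. Its order at u is therefore one less than that of r, hence at most n - 1, and in
    case of equality r is a constant times (X - u)^n. *)
Lemma wronp_order A B u n : nz2 A.[u] B.[u] ->
  (forall s t, nz2 s t -> s *: A + t *: B != 0) ->
  (size A <= n.+1)%N -> (size B <= n.+1)%N ->
  [/\ wronp A B != 0, (mup u (wronp A B) <= n.-1)%N &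
    mup u (wronp A B) = n.-1 -> (0 < n)%N -> exists s t e, [/\ nz2 s t, e != 0 &
      s *: A + t *: B = e *: ('X - u%:P) ^+ n]].
Proof.
wlog Bu : A B / B.[u] != 0 => [hw|] AB ind sA sB.
  have [B0|B0] := eqVneq B.[u] 0; last exact: hw.
  have A0 : A.[u] != 0 by move: AB; rewrite /nz2 B0 eqxx orbF.
  have [||||h1 h2 h3] := hw B A A0 => //.
  - by rewrite /nz2 A0 orbT.
  - by move=> s t st; rewrite addrC; apply: ind; rewrite /nz2 orbC.
  have -> : wronp A B = (-1) *: wronp B A by rewrite /wronp scaleN1r; ring.
  rewrite mup_neq0_scale ?oppr_eq0 ?oner_eq0 // scaler_eq0 oppr_eq0 oner_eq0.
  split => // h n0; have [s [t [e [st e0 E]]]] := h3 h n0.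
  by exists t, s, e; rewrite addrC; split => //; rewrite /nz2 orbC.
pose r := B.[u] *: A - A.[u] *: B.
have st : nz2 B.[u] (- A.[u]) by rewrite /nz2 Bu.
have r0 : r != 0 by rewrite /r -scaleNr; exact: ind.
have ru : root r u by rewrite /root /r !hornerE mulrC subrr.
have [W0 mW] := mup_wronp r0 ru Bu.
have sr : (size r <= n.+1)%N.
  rewrite /r (leq_trans (size_polyD _ _)) // geq_max size_polyN.
  by rewrite !(leq_trans (size_scale_leq _ _)).
have le_mn : (mup u r <= n)%N by rewrite -ltnS (leq_trans (mup_lt_size _ r0)).
move: W0 mW; rewrite wronp_subl mup_neq0_scale // scaler_eq0 negb_or => /andP[_ W0] mW.
split => //; first by rewrite mW -!subn1 leq_sub2r.
rewrite mW => h n0; have m1 : mup u r = n.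
  have : (0 < mup u r)%N by rewrite -XsubC_dvd // dvdp_XsubCl.
  by move: h n0; case: (mup u r) n {sr le_mn sA sB} => [|?] [|?] //= -> .
have [e e0 E] := mup_max r0 sr m1.
by exists B.[u], (- A.[u]), e; split => //; rewrite scaleNr.
Qed.

Lemma rvD n s t p q : rv n (s *: p + t *: q) = s *: rv n p + t *: rv n q.
Proof.
apply/polyP => i; rewrite coefD !coefZ.
have [le_in|lt_ni] := leqP i n; first by rewrite !coef_rv // coefD !coefZ.
by rewrite !nth_default ?mulr0 ?addr0 // (leq_trans (size_poly _ _)).
Qed.

Lemma rvK n p : (size p <= n.+1)%N -> rv n (rv n p) = p.
Proof.
move=> sp; apply/polyP => i; have [le_in|lt_ni] := leqP i n.
  by rewrite !coef_rv ?leq_subr // subKn.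
by rewrite !nth_default // (leq_trans _ lt_ni) // size_poly.
Qed.

(** A linear relation makes one of p, q divide the other, and by coprimality both are then
    constant. *)
Lemma rat_indep p q s t : coprimep p q -> (0 < rdeg p q)%N -> nz2 s t ->
  s *: p + t *: q != 0.
Proof.
move=> cpq n0 st; apply: contraTneq n0 => e.
wlog s0 : p q s t cpq st e / s != 0 => [hw|].
  have [s0|s0] := eqVneq s 0; last exact: hw st e s0.
  rewrite /rdeg maxnC; apply: (hw q p t s); rewrite 1?coprimep_sym 1?addrC //.
    by rewrite /nz2 orbC.
  by move: st; rewrite /nz2 s0 eqxx.
have qp : q %| p.
  rewrite -(dvdpZr _ _ s0) (_ : s *: p = (- t) *: q) //.
    by rewrite -mul_polyC dvdp_mulIr.
  by apply/eqP; rewrite scaleNr -addr_eq0 e.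
have sq : size q = 1%N.
  by apply/eqP; rewrite -coprimepp; first [exact: coprimep_dvdl qp cpq|exact: coprimep_dvdr qp cpq].
have sp : (size p <= 1)%N.
  have -> : p = (- t / s) *: q.
    apply: (scalerI s0); rewrite scalerA mulrCA divff // mulr1 scaleNr.
    by apply/eqP; rewrite -addr_eq0 e.
  by rewrite (leq_trans (size_scale_leq _ _)) // sq.
by rewrite /rdeg sq (maxn_idPr sp).
Qed.

Lemma chart_indep p q z s t : coprimep p q -> (0 < rdeg p q)%N -> nz2 s t ->
  s *: chart_poly z (rdeg p q) p + t *: chart_poly z (rdeg p q) q != 0.
Proof.
move=> cpq n0 st; have := rat_indep cpq n0 st.
case: z => [u|] //=; apply: contraNneq; rewrite -rvD => /(congr1 (rv (rdeg p q))).
rewrite rvK => [->|].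
  by apply/eqP/polyP => i; rewrite coef_poly !coef0; case: ifP.
rewrite (leq_trans (size_polyD _ _)) // geq_max.
by rewrite !(leq_trans (size_scale_leq _ _)) ?size_rdegl ?size_rdegr.
Qed.

(** The linear form vanishing exactly at z. *)
Definition ell z x y := if z is Some u then x - u * y else y.

(** The local degree at z minus one, for p/q in lowest terms and nonconstant. *)
Definition ramif p q z := mup (gcoord_at z z)
  (wronp (chart_poly z (rdeg p q) p) (chart_poly z (rdeg p q) q)).

Lemma size_chart z n p : (size p <= n.+1)%N -> (size (chart_poly z n p) <= n.+1)%N.
Proof. by case: z => //= _; exact: size_poly. Qed.

Lemma ramifP p q z : coprimep p q -> (0 < rdeg p q)%N ->
  let n := rdeg p q in
  [/\ wronp (chart_poly z n p) (chart_poly z n q) != 0, (ramif p q z <= n.-1)%N &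
    ramif p q z = n.-1 -> exists s t e, [/\ nz2 s t, e != 0 &
      forall x y, s * homog n p x y + t * homog n q x y = e * ell z x y ^+ n]].
Proof.
move=> cpq n0 n; have := chart_poly_nz2 z (gcoord_at z z) cpq.
move=> /wronp_order /(_ (fun s t => @chart_indep p q z s t cpq n0)).
move=> /(_ n (size_chart z (size_rdegl p q)) (size_chart z (size_rdegr p q))).
move=> [W0 le_m h]; split => // /h /(_ n0)[s [t [e [st e0 E]]]].
exists s, t, e; split => // x y; rewrite -!homogZ -homogD.
case: z E {W0 le_m h} => [u|] /= E.
  by rewrite E homogZ homog_XsubCn.
(* At infinity the chart identity concerns reversed polynomials: e X^n there is the constant e
   here. *)
suff -> : s *: p + t *: q = e%:P by rewrite homog_C.
rewrite -[LHS](rvK (n := n)); last first.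
  rewrite (leq_trans (size_polyD _ _)) // geq_max.
  by rewrite !(leq_trans (size_scale_leq _ _)) ?size_rdegl ?size_rdegr.
rewrite rvD E subr0 -[X in rv n X]addr0 -polyC0 rv_nf // scale0r add0r //.
Qed.

Lemma ramif_eq0 p q z : coprimep p q -> (0 < rdeg p q)%N ->
  (ramif p q z == 0%N) = (glocal_deriv (gratmap p q) z != 0).
Proof.
move=> cpq n0; have [W0 _ _] := ramifP z cpq n0.
rewrite local_deriv_eq0 // -horner_wronp -/(root _ _) -dvdp_XsubCl XsubC_dvd //.
by rewrite -eqn0Ngt.
Qed.

Lemma horner_deriv_wide m r u : (size r <= m)%N ->
  u * r^`().[u] = \sum_(i < m) (r`_i * u ^+ i) *+ i.
Proof.
move=> sr; have -> : r = \poly_(i < m) r`_i.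
  apply/polyP => i; rewrite coef_poly; case: ltnP => // /(leq_trans sr) le_i.
  by rewrite nth_default.
rewrite poly_def raddf_sum horner_sum mulr_sumr; apply: eq_bigr => i _.
rewrite -poly_def coef_poly ltn_ord /= derivZ derivXn hornerZ hornerMn hornerXn.
case: (nat_of_ord i) => [|k]; first by rewrite !mulr0n !mulr0.
by rewrite /= !mulrnAr mulrCA -exprS.
Qed.

(** The Wronskian of two forms of degree n has weight 2 n - 2: this is what makes it possible to
    count its zeros over the whole sphere. *)
Lemma wron_rv n p q w : (0 < n)%N -> (size p <= n.+1)%N -> (size q <= n.+1)%N ->
  w != 0 -> wron (rv n p) (rv n q) w = - (w ^+ n.-1 ^+ 2 * wron p q w^-1).
Proof.
move=> n0 sp sq w0.
(* Euler's identity for the form attached to r. In the Wronskian the two products with the factor n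
   cancel. *)
have dE r : (size r <= n.+1)%N ->
    w * (rv n r)^`().[w] = n%:R * homog n r 1 w - w ^+ n.-1 * r^`().[w^-1].
  move=> sr; have -> : w ^+ n.-1 * r^`().[w^-1] = w ^+ n * (w^-1 * r^`().[w^-1]).
    by rewrite -{2}(prednK n0) exprS mulrA [w * _ / _]mulrAC divff // mul1r.
  rewrite (horner_deriv_wide _ (size_poly _ _)) (horner_deriv_wide _ sr).
  rewrite -horner_rv // horner_poly !mulr_sumr.
  rewrite [X in _ - X](reindex_inj rev_ord_inj) /= -sumrB.
  apply: eq_bigr => i _; have le_in : (i <= n)%N by rewrite -ltnS.
  have e : w ^+ n / w ^+ (n - i) = w ^+ i.
    by rewrite -expfB_cond ?(negPf w0) ?leq_subr // subKn.
  rewrite coef_poly ltn_ord subSS exprVn mulrnAr [w ^+ n * _]mulrCA e mulrnBr //.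
  by rewrite mulr_natl subKr.
apply: (mulfI w0); rewrite /wron mulrBr mulrA dE // [X in _ - X]mulrCA dE //.
rewrite !horner_rv // /homog (negPf w0) mul1r -(prednK n0) /= !exprS.
ring.
Qed.

Lemma poly_all0 A : (forall w, A.[w] = 0) -> A = 0.
Proof.
move=> A0; apply/eqP/negPn/negP => nA.
have := max_poly_roots nA (rs := [seq i%:R | i <- iota 0 (size A)]).
rewrite size_map size_iota ltnn => h; suff : false by []; apply: h.
  by apply/allP => w _; rewrite /root A0.
by rewrite map_inj_uniq ?iota_uniq // => i j /eqP; rewrite eqr_nat => /eqP.
Qed.

Lemma poly_eq_nz A B u : (forall w, w != u -> A.[w] = B.[w]) -> A = B.
Proof.
move=> AB; apply/eqP; rewrite -subr_eq0; apply/eqP.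
have /poly_all0/eqP : forall w, ((A - B) * ('X - u%:P)).[w] = 0.
  move=> w; rewrite !hornerE; have [->|wu] := eqVneq w u; first by rewrite subrr mulr0.
  by rewrite AB // subrr mul0r.
by rewrite mulf_eq0 polyXsubC_eq0 orbF => /eqP.
Qed.

(** The Riemann-Hurwitz count: the zeros of the Wronskian, infinity included, are 2 n - 2. It is
    obtained by comparing orders at 0 in the reversal identity [wron_rv]. *)
Lemma ramif_sum p q (n := rdeg p q) (W := wronp p q) (rs : seq F) :
  coprimep p q -> (0 < n)%N -> W = lead_coef W *: \prod_(r <- rs) ('X - r%:P) ->
  (size rs + ramif p q None)%N = n.-1.*2.
Proof.
move=> cpq n0 WE; have [V0 _ _] := ramifP None cpq n0.
have [W0 _ _] := ramifP (Some 0) cpq n0.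
(* The reversal of the product of the linear factors; as G(0) = 1 it does not contribute to the
   order at 0. *)
pose G := \prod_(r <- rs) (1 - r *: 'X).
have /(congr1 (mup 0)) : 'X^(size rs) * wronp (rv n p) (rv n q) =
    'X^(n.-1.*2) * (- lead_coef W *: G).
  apply: (@poly_eq_nz _ _ 0) => w w0.
  rewrite !(hornerM, hornerZ) !hornerXn horner_wronp wron_rv ?size_rdegl ?size_rdegr //.
  rewrite -horner_wronp -/W horner_prod.
  have -> : W.[w^-1] = lead_coef W * \prod_(r <- rs) ('X - r%:P).[w^-1].
    by rewrite [in LHS]WE hornerZ horner_prod.
  have -> : \prod_(r <- rs) (1 - r *: 'X).[w] =
      w ^+ size rs * \prod_(r <- rs) ('X - r%:P).[w^-1].
    elim: rs {WE G} => [|r rs ih]; first by rewrite !big_nil mulr1.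
    rewrite !big_cons ih /= exprS !hornerE.
    have : w / w = 1 by rewrite divff.
    by move=> h; rewrite /= -[X in X - r * w]h; ring.
  by rewrite -muln2 exprM; ring.
have G0 : ~~ root G 0.
  rewrite /root horner_prod prodf_seq_neq0; apply/allP => r _.
  by rewrite !hornerE ?mulr0 subr0 oner_neq0.
have G0' : G != 0 by apply: contraNneq G0 => ->; rewrite root0.
have XnE k : 'X^k = ('X - 0%:P) ^+ k :> {poly F} by rewrite subr0.
have lW : - lead_coef W != 0 by rewrite oppr_eq0 lead_coef_eq0.
rewrite !mupM ?scaler_eq0 ?negb_or ?lW ?G0' ?expf_neq0 ?polyX_eq0 //.
rewrite !XnE !mup_XsubCX eqxx mup_neq0_scale // (mupNroot G0) addn0 => <-.
by rewrite /ramif.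
Qed.

(** The total 2 (n - 1) is concentrated at two points, each carrying at most n - 1, so each carries
    exactly n - 1. *)
Lemma ramif_total p q z1 z2 : coprimep p q -> (1 < rdeg p q)%N -> z1 <> z2 ->
  (forall z, glocal_deriv (gratmap p q) z = 0 -> z = z1 \/ z = z2) ->
  ramif p q z1 = (rdeg p q).-1 /\ ramif p q z2 = (rdeg p q).-1.
Proof.
move=> cpq n1 z12 crit; have n0 := ltnW n1.
have [W0 _ _] := ramifP (Some 0) cpq n0; rewrite /= in W0.
have [rs rsE] := closed_field_poly_normal (wronp p q).
have T := ramif_sum cpq n0 rsE.
have rsome u : ramif p q (Some u) = count_mem u rs.
  rewrite /ramif /= {1}rsE mup_neq0_scale ?lead_coef_eq0 //.
  exact: mu_prod_XsubC.
have crit' z : ramif p q z != 0%N -> z = z1 \/ z = z2.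
  by rewrite ramif_eq0 // negbK => /eqP; exact: crit.
have rsP u : u \in rs -> Some u = z1 \/ Some u = z2.
  by move=> urs; apply: crit'; rewrite rsome -lt0n -has_count has_pred1.
have [_ le1 _] := ramifP z1 cpq n0; have [_ le2 _] := ramifP z2 cpq n0.
suff : (size rs + ramif p q None = ramif p q z1 + ramif p q z2)%N.
  by rewrite T -addnn; lia.
clear crit le1 le2.
have rNone : z1 <> None -> z2 <> None -> ramif p q None = 0%N.
  by move=> h1 h2; apply/eqP/negPn/negP => /crit'[]/esym.
(* The claim is symmetric in the two points, and at most one of them is infinity. *)
clear crit'; wlog z1S : z1 z2 z12 rsP rNone / z1 <> None.
  case: z1 z12 rsP rNone => [u|] z12 rsP rNone hw; first exact: hw.
  rewrite addnC [RHS]addnC addnC; apply: hw.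
  - by move=> e; apply: z12.
  - by move=> u /rsP[]; [right|left].
  - by move=> h1 h2; apply: rNone.
  - by move=> e; apply: z12.
case: z1 z1S z12 rsP rNone => [u1|] // _; case: z2 => [u2|] z12 rsP rNone.
  rewrite rNone // addn0 !rsome.
  rewrite -(count_predC (pred1 u1)); congr addn.
  apply: eq_in_count => r /rsP rP /=; have [e|ne] := eqVneq r u1.
    by apply/esym/eqP => e2; apply: z12; rewrite -e -e2.
  by case: rP => -[e]; [rewrite e eqxx in ne|rewrite e eqxx].
congr addn; rewrite rsome -[LHS](count_predT rs).
by apply: eq_in_count => r /rsP[[->]|//] /=; rewrite eqxx.
Qed.

Lemma ell_sep z1 z2 : z1 <> z2 ->
  exists a b c d, a * d - b * c != 0 /\
    forall x y, ell z1 x y = a * x + b * y /\ ell z2 x y = c * x + d * y.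
Proof.
move=> z12; case: z1 z2 z12 => [u1|] [u2|] // z12.
- exists 1, (- u1), 1, (- u2); split; last by move=> x y; rewrite /= !mul1r !mulNr.
  by rewrite mul1r mulr1 opprK addrC subr_eq0; apply/eqP => e; apply: z12; rewrite e.
- exists 1, (- u1), 0, 1; split; last by move=> x y; rewrite /= !mul1r mulNr mul0r add0r.
  by rewrite mulr1 mulr0 subr0 oner_neq0.
- exists 0, 1, 1, (- u2); split; last by move=> x y; rewrite /= !mul1r mulNr mul0r add0r.
  by rewrite mul0r mulr1 sub0r oppr_eq0 oner_neq0.
Qed.

(** Total ramification gives s1 p + t1 q = e1 u^n and s2 p + t2 q = e2 v^n, with u and v linear
    forms vanishing at z1 and z2. Solving for p and q expresses the map through u^n and v^n, and
    [x : y] -> [u : v] is the conjugacy; it sends z1 to 0 and z2 to infinity. *)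
Lemma gconj_normal_form p q z1 z2 : coprimep p q -> (1 < rdeg p q)%N -> z1 <> z2 ->
  (forall z, glocal_deriv (gratmap p q) z = 0 -> z = z1 \/ z = z2) ->
  exists a b c d, a * d - b * c != 0 /\
    gconj (gratmap p q) (gnf (rdeg p q) a b c d).
Proof.
move=> cpq n1 z12 crit; have n0 := ltnW n1; set n := rdeg p q in n1 n0 *.
have [r1 r2] := ramif_total cpq n1 z12 crit.
have [_ _ /(_ r1)] := ramifP z1 cpq n0; have [_ _ /(_ r2)] := ramifP z2 cpq n0.
move=> [s2 [t2 [e2 [st2 e20 E2]]]] [s1 [t1 [e1 [st1 e10 E1]]]].
rewrite -/n in E1 E2.
have [m1 [m2 [m3 [m4 [D0 mE]]]]] := ell_sep z12.
have sol u v : exists x y, ell z1 x y = u /\ ell z2 x y = v.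
  pose D := m1 * m4 - m2 * m3.
  exists ((m4 * u - m2 * v) / D), ((m1 * v - m3 * u) / D).
  by have [-> ->] := mE ((m4 * u - m2 * v) / D) ((m1 * v - m3 * u) / D);
    split; rewrite /D; field.
(* If De vanished, u^n and v^n would be proportional; the points where (u, v) is (1, 0) and (0, 1)
   exclude this. *)
pose De := s1 * t2 - s2 * t1.
have De0 : De != 0.
  apply/eqP => De0.
  have [x [y [ex ey]]] := sol 1 0; have [x' [y' [ex' ey']]] := sol 0 1.
  have := E1 x y; have := E2 x y; have := E1 x' y'; have := E2 x' y'.
  rewrite ex ey ex' ey' expr1n expr0n (gtn_eqF n0) !mulr1 !mulr0.
  set P := homog n p x y; set Q := homog n q x y.
  set P' := homog n p x' y'; set Q' := homog n q x' y' => f4 f3 f2 f1.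
  have g1 : t2 * e1 = 0.
    by rewrite -f1 (_ : _ * _ = De * P + t1 * (s2 * P + t2 * Q)); [rewrite De0 f2; ring|rewrite /De; ring].
  have g2 : s2 * e1 = 0.
    by rewrite -f1 (_ : _ * _ = - De * Q + s1 * (s2 * P + t2 * Q)); [rewrite De0 f2; ring|rewrite /De; ring].
  move: g1 g2 st2 => /eqP + /eqP; rewrite !mulf_eq0 (negPf e10) !orbF /nz2.
  by move=> -> ->.
(* Cramer's rule: De p = A u^n + B v^n and De q = C u^n + D v^n. *)
pose A := t2 * e1; pose B := - (t1 * e2); pose C := - (s2 * e1); pose D := s1 * e2.
have AD0 : A * D - B * C != 0.
  by rewrite (_ : _ - _ = e1 * e2 * De) ?mulf_neq0 // /A /B /C /D /De; ring.
exists (m1 * A + m2 * C), (m1 * B + m2 * D), (m3 * A + m4 * C), (m3 * B + m4 * D).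
have D1 : (m1 * A + m2 * C) * (m3 * B + m4 * D) - (m1 * B + m2 * D) * (m3 * A + m4 * C) != 0.
  by rewrite (_ : _ - _ = (m1 * m4 - m2 * m3) * (A * D - B * C)) ?mulf_neq0 //; ring.
split => //; exists (gmob m1 m2 m3 m4); split; first by exists m1, m2, m3, m4.
apply/funext => z; have [x [y [xy ->]]] := hptP z.
rewrite /= ratmap_hpt // -/n !mob_hpt ?(det_nz2 D0) //; last exact: homog_nz2.
rewrite nf_hpt ?(det_nz2 D1) //; last exact: nz2_lin.
have [<- <-] := mE x y; set u := ell z1 x y; set v := ell z2 x y.
have eP : De * homog n p x y = A * u ^+ n + B * v ^+ n.
  by rewrite /De /A /B mulNr -!mulrA -E1 -E2; ring.
have eQ : De * homog n q x y = C * u ^+ n + D * v ^+ n.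
  by rewrite /De /C /D mulNr -!mulrA -E1 -E2; ring.
rewrite -[LHS](hpt_scale _ _ De0); congr hpt.
  by rewrite mulrDr ![De * (_ * _)]mulrCA eP eQ; ring.
by rewrite mulrDr ![De * (_ * _)]mulrCA eP eQ; ring.
Qed.

End NormalForm.

(** * Conjugacy of normal forms and the invariants X and Y *)

Section Invariants.
Variable F : numClosedFieldType.
Implicit Types (x y s t k a b c d : F) (z : option F).
Implicit Types (f g mu : option F -> option F).

Lemma nz2_parallel a c a' c' : nz2 a c -> nz2 a' c' -> a * c' = a' * c ->
  exists k, [/\ k != 0, a = k * a' & c = k * c'].
Proof.
rewrite /nz2; have [a0|a0] := eqVneq a' 0.
  rewrite a0 mul0r /= => ac c'0 /eqP; rewrite mulf_eq0 (negPf c'0) orbF => /eqP ea.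
  exists (c / c'); split; rewrite ?ea ?mulr0 ?divfK //.
  by rewrite mulf_neq0 ?invr_eq0 //; move: ac; rewrite ea eqxx.
move=> ac _ e; have [ea|ea] := eqVneq a 0.
  move: e ac; rewrite ea mul0r eqxx /= => /esym/eqP.
  by rewrite mulf_eq0 (negPf a0) => /= ->.
exists (a / a'); split; rewrite ?divfK ?mulf_neq0 ?invr_eq0 //.
by apply: (mulfI a0); rewrite -e; field.
Qed.

Lemma nf_scale n k a b c d : (0 < n)%N -> k != 0 -> a * d - b * c != 0 ->
  gnf n (k * a) (k * b) (k * c) (k * d) = gnf n a b c d.
Proof.
move=> n0 k0 D0; apply/funext => z; have [x [y [xy ->]]] := hptP z.
have ac := det_nz2 D0.
rewrite !nf_hpt // -?mulrA -?mulrDr ?hpt_scale //.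
by rewrite /nz2 !mulf_eq0 (negPf k0).
Qed.

(** The values at infinity and 0 determine the columns (a, c) and (b, d) up to one factor each, and
    the value at 1 makes the two factors equal. *)
Lemma nf_eq n a b c d a' b' c' d' : (0 < n)%N ->
  a * d - b * c != 0 -> a' * d' - b' * c' != 0 ->
  gnf n a b c d = gnf n a' b' c' d' ->
  exists k, [/\ k != 0, a = k * a', b = k * b', c = k * c' & d = k * d'].
Proof.
move=> n0 D0 D0' e; have ac := det_nz2 D0; have ac' := det_nz2 D0'.
have bd : nz2 b d by move: (nz2_lin D0 (x := 0) (y := 1)); rewrite /nz2 oner_eq0 orbT !mulr0 !mulr1 !add0r; apply.
have bd' : nz2 b' d' by move: (nz2_lin D0' (x := 0) (y := 1)); rewrite /nz2 oner_eq0 orbT !mulr0 !mulr1 !add0r; apply.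
have ev x y : nz2 x y -> gnf n a b c d (hpt x y) = gnf n a' b' c' d' (hpt x y) by rewrite e.
have := ev 1 0; rewrite /nz2 oner_eq0 => /(_ isT).
rewrite !nf_hpt ?/nz2 ?oner_eq0 // expr1n expr0n (gtn_eqF n0) !mulr0 !mulr1 !addr0.
move=> /hpt_cross /(nz2_parallel ac ac')[k [k0 ea ec]].
have := ev 0 1; rewrite /nz2 oner_eq0 orbT => /(_ isT).
rewrite !nf_hpt ?/nz2 ?oner_eq0 ?orbT // expr1n expr0n (gtn_eqF n0) !mulr0 !mulr1 !add0r.
move=> /hpt_cross /(nz2_parallel bd bd')[l [l0 eb ed]].
have := ev 1 1; rewrite /nz2 oner_eq0 => /(_ isT).
rewrite !nf_hpt ?/nz2 ?oner_eq0 // expr1n !mulr1 => /hpt_cross.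
rewrite ea eb ec ed => /eqP; rewrite -subr_eq0.
rewrite (_ : _ - _ = (k - l) * (a' * d' - b' * c')); last by ring.
rewrite mulf_eq0 (negPf D0') orbF subr_eq0 => /eqP kl.
by exists k; rewrite kl.
Qed.

Lemma mob_nf n m1 m2 m3 m4 a b c d : (0 < n)%N ->
  m1 * m4 - m2 * m3 != 0 -> a * d - b * c != 0 ->
  gmob m1 m2 m3 m4 \o gnf n a b c d =
  gnf n (m1 * a + m2 * c) (m1 * b + m2 * d) (m3 * a + m4 * c) (m3 * b + m4 * d).
Proof.
move=> n0 D0 D0'; have ac := det_nz2 D0; have ac' := det_nz2 D0'.
apply/funext => z; have [x [y [xy ->]]] := hptP z.
have xyn : nz2 (x ^+ n) (y ^+ n) by rewrite /nz2 !expf_eq0 n0.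
rewrite /= !nf_hpt // ?mob_hpt //; first by congr hpt; ring.
  exact: nz2_lin D0' xyn.
exact: nz2_lin D0 ac'.
Qed.

Lemma nf_diag n a b c d k l : (0 < n)%N -> a * d - b * c != 0 -> k * l != 0 ->
  gnf n a b c d \o gmob k 0 0 l =
  gnf n (a * k ^+ n) (b * l ^+ n) (c * k ^+ n) (d * l ^+ n).
Proof.
move=> n0 D0; rewrite mulf_eq0 negb_or => /andP[k0 l0]; have ac := det_nz2 D0.
apply/funext => z; have [x [y [xy ->]]] := hptP z.
have kl : nz2 (k * x) (l * y) by rewrite /nz2 !mulf_eq0 (negPf k0) (negPf l0).
rewrite /= mob_hpt /nz2 ?k0 // !mul0r addr0 add0r !nf_hpt //.
  by rewrite !exprMn !mulrA.
by rewrite /nz2 !mulf_eq0 !expf_eq0 (negPf k0) !andbF !orbF.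
Qed.

Lemma nf_antidiag n a b c d k l : (0 < n)%N -> a * d - b * c != 0 -> k * l != 0 ->
  gnf n a b c d \o gmob 0 k l 0 =
  gnf n (b * l ^+ n) (a * k ^+ n) (d * l ^+ n) (c * k ^+ n).
Proof.
move=> n0 D0; rewrite mulf_eq0 negb_or => /andP[k0 l0]; have ac := det_nz2 D0.
have bd : nz2 b d by move: (nz2_lin D0 (x := 0) (y := 1)); rewrite /nz2 oner_eq0 orbT !mulr0 !mulr1 !add0r; apply.
apply/funext => z; have [x [y [xy ->]]] := hptP z.
have kl : nz2 (k * y) (l * x) by rewrite /nz2 orbC !mulf_eq0 (negPf k0) (negPf l0).
rewrite /= mob_hpt /nz2 ?l0 ?orbT // !mul0r addr0 add0r !nf_hpt //.
  by rewrite !exprMn !mulrA; congr hpt; rewrite addrC.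
by rewrite /nz2 !mulf_eq0 !expf_eq0 (negPf l0) !andbF !orbF.
Qed.

(* The critical points of a normal form are characterized without derivatives,
   so that their invariance under conjugacy is immediate. *)
Definition fully_ramified f z := forall z', f z' = f z -> z' = z.

(** The map is a Möbius map of z^n, so multiplication by an n-th root of unity e other than 1
    preserves its fibres, and it moves every point except 0 and infinity. *)
Lemma nf_fully_ramified n a b c d z : (1 < n)%N -> a * d - b * c != 0 ->
  fully_ramified (gnf n a b c d) z <-> z = Some 0 \/ z = None.
Proof.
move=> n1 D0; have n0 := ltnW n1; have ac := det_nz2 D0.
have nfE z' : gnf n a b c d z' = gmob a b c d (omap (fun w => w ^+ n) z').
  case: z' => [w|].
    rewrite -[omap _ _]/(Some (w ^+ n)) !hptS nf_hpt ?mob_hpt // /nz2 ?oner_eq0 ?orbT //.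
    by rewrite expr1n.
  rewrite -[omap _ _]/(@None F) hptN nf_hpt ?mob_hpt // /nz2 ?oner_eq0 //.
  by rewrite expr1n expr0n (gtn_eqF n0).
have mob_inj : injective (gmob a b c d) by apply: gmobius_inj; exists a, b, c, d.
split; last first.
  move=> h z'; rewrite !nfE => /mob_inj; case: h => ->.
    case: z' => [w|] //= [] /eqP; rewrite expr0n (gtn_eqF n0) expf_eq0 n0.
    by move=> /eqP->.
  by case: z'.
case: z => [w|]; last by right.
move=> ram; left; congr Some; apply/eqP/negPn/negP => w0.
(* A root of 1 + X + ... + X^(n-1); it is not 1, where the value is n. *)
have [e en e1] : exists2 e : F, e ^+ n = 1 & e != 1.
  have [|e] := closed_rootP (\poly_(i < n) (1 : F)) _.
    by rewrite size_poly_eq ?oner_eq0 // (gtn_eqF n1).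
  rewrite /root horner_poly; under eq_bigr do rewrite mul1r.
  move=> /eqP e0; exists e; first by apply/eqP; rewrite -subr_eq0 subrX1 e0 mulr0.
  apply: contra_eqN e0 => /eqP->; under eq_bigr do rewrite expr1n.
  by rewrite sumr_const card_ord pnatr_eq0 -lt0n.
have := ram (Some (e * w)); rewrite !nfE /= exprMn en mul1r => /(_ erefl)[] /eqP.
rewrite -subr_eq0 -{2}[w]mul1r -mulrBl mulf_eq0 (negPf w0) orbF.
by rewrite subr_eq0 (negPf e1).
Qed.

Lemma conj_fully_ramified f g mu z : gmobius mu -> mu \o f = g \o mu ->
  fully_ramified f z -> fully_ramified g (mu z).
Proof.
move=> mmu e fz z'; have [nu [_ e1 e2]] := gmobius_inv mmu.
have muK w : mu (nu w) = w by rewrite -[LHS]/((mu \o nu) w) e1.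
have ge w : g (mu w) = mu (f w) by rewrite -[LHS]/((g \o mu) w) -e.
by rewrite -{1}(muK z') !ge => /(gmobius_inj mmu)/fz <-; rewrite muK.
Qed.

(** A conjugacy permutes the fully ramified points 0 and infinity, so it has the form k z or k / z.
    In both cases b c and a d - b c are multiplied by the same factor. *)
Lemma nf_conj_X n a b c d a' b' c' d' : (1 < n)%N ->
  a * d - b * c != 0 -> a' * d' - b' * c' != 0 ->
  gconj (gnf n a b c d) (gnf n a' b' c' d') ->
  b * c / (a * d - b * c) = b' * c' / (a' * d' - b' * c').
Proof.
move=> n1 D0 D0' [mu [mmu e]]; have n0 := ltnW n1.
have ram z : z = Some 0 \/ z = None -> mu z = Some 0 \/ mu z = None.
  move=> /(nf_fully_ramified z n1 D0) /(conj_fully_ramified mmu e).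
  by move/(nf_fully_ramified _ n1 D0').
have mu0 := ram _ (or_introl erefl); have muoo := ram _ (or_intror erefl).
have mu_inj := gmobius_inj mmu.
have muN : mu (Some 0) <> mu None by move/mu_inj.
move: mmu => [m1 [m2 [m3 [m4 [M0 muE]]]]].
have m13 := det_nz2 M0.
have e0 : mu (Some 0) = hpt m2 m4.
  by rewrite muE hptS mob_hpt /nz2 ?oner_eq0 ?orbT // !mulr0 !mulr1 !add0r.
have eoo : mu None = hpt m1 m3.
  by rewrite muE hptN mob_hpt /nz2 ?oner_eq0 // !mulr0 !mulr1 !addr0.
have hpt0 x y : nz2 x y -> hpt x y = Some 0 -> x = 0.
  by move=> xy; rewrite hptS => /hpt_cross; rewrite mulr1 mul0r.
have hptoo x y : hpt x y = None -> y = 0.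
  by rewrite hptN => /hpt_cross; rewrite mulr0 mul1r.
have m24 : nz2 m2 m4.
  move: (nz2_lin M0 (x := 0) (y := 1)).
  by rewrite /nz2 oner_eq0 orbT !mulr0 !mulr1 !add0r; apply.
have key u v w1 w2 p : p != 0 -> u * v != 0 -> w1 * w2 != 0 ->
    u * v * (a * d - b * c) = p * (w1 * w2) * (a' * d' - b' * c') ->
    u * v * (b * c) = p * (w1 * w2) * (b' * c') ->
  b * c / (a * d - b * c) = b' * c' / (a' * d' - b' * c').
  move=> p0 uv0 w0 eD eX; apply/eqP; rewrite eqr_div //; apply/eqP.
  apply: (mulfI uv0); rewrite mulrA eX.
  by rewrite [RHS]mulrCA eD; ring.
case: mu0 muoo => h0 [] hoo.
- by case: muN; rewrite h0 hoo.
- have z2 : m2 = 0 by apply: (hpt0 _ _ m24); rewrite -e0.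
  have z3 : m3 = 0 by apply: (hptoo m1); rewrite -eoo.
  rewrite z2 z3 mulr0 subr0 in M0 muE.
  have M0n : m1 ^+ n * m4 ^+ n != 0 by rewrite -exprMn expf_neq0.
  move: e; rewrite muE mob_nf // ?mulr0 ?subr0 // nf_diag // !mul0r !addr0 !add0r.
  case/nf_eq => //.
  - have e1 := mulf_neq0 M0 D0; apply: contraNneq e1 => e1.
    by apply/eqP; rewrite -[RHS]e1; ring.
  - have e1 := mulf_neq0 M0n D0'; apply: contraNneq e1 => e1.
    by apply/eqP; rewrite -[RHS]e1; ring.
  move=> k [k0 ea eb ec ed]; apply: (key m1 m4 (m1 ^+ n) (m4 ^+ n) (k ^+ 2)); rewrite ?expf_neq0 //.
    rewrite (_ : _ * _ = (m1 * a) * (m4 * d) - (m1 * b) * (m4 * c)); last by ring.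
    by rewrite ea eb ec ed; ring.
  rewrite (_ : _ * _ = (m1 * b) * (m4 * c)); last by ring.
  by rewrite eb ec; ring.
- have z4 : m4 = 0 by apply: (hptoo m2); rewrite -e0.
  have z1 : m1 = 0 by apply: (hpt0 _ _ m13); rewrite -eoo.
  rewrite z1 z4 mulr0 sub0r oppr_eq0 in M0 muE.
  have M0n : m2 ^+ n * m3 ^+ n != 0 by rewrite -exprMn expf_neq0.
  move: e; rewrite muE mob_nf // ?mulr0 ?sub0r ?oppr_eq0 // nf_antidiag // !mul0r !addr0 !add0r.
  case/nf_eq => //.
  - have e1 := mulf_neq0 M0 D0; apply: contraNneq e1 => e1.
    by apply/eqP; rewrite -[RHS]oppr0 -e1; ring.
  - have e1 := mulf_neq0 M0n D0'; apply: contraNneq e1 => e1.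
    by apply/eqP; rewrite -[RHS]oppr0 -e1; ring.
  move=> k [k0 ea eb ec ed]; apply: (key m2 m3 (m2 ^+ n) (m3 ^+ n) (k ^+ 2)); rewrite ?expf_neq0 //.
    rewrite (_ : _ * _ = (m3 * a) * (m2 * d) - (m3 * b) * (m2 * c)); last by ring.
    by rewrite ea eb ec ed; ring.
  rewrite (_ : _ * _ = (m3 * b) * (m2 * c)); last by ring.
  by rewrite ea ed; ring.
- by case: muN; rewrite h0 hoo.
Qed.

(** Conjugation by 1/z. *)
Lemma nf_swap n a b c d : (0 < n)%N -> a * d - b * c != 0 ->
  gconj (gnf n a b c d) (gnf n d c b a).
Proof.
move=> n0 D0; exists (gmob 0 1 1 0).
have M : 0 * 0 - 1 * 1 != 0 :> F by rewrite mul0r sub0r mulr1 oppr_eq0 oner_eq0.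
split; first by exists 0, 1, 1, 0.
have D0' : d * a - c * b != 0 by rewrite [d * a]mulrC [c * b]mulrC.
rewrite mob_nf // nf_antidiag ?mulr1 ?oner_eq0 //.
by rewrite expr1n !mul0r !mul1r !mulr1 !addr0 !add0r.
Qed.

(** Conjugation by k z; the factor s uses the freedom to scale all coefficients at once. *)
Lemma nf_rescale n a b c d s k : (0 < n)%N -> a * d - b * c != 0 -> s != 0 -> k != 0 ->
  gconj (gnf n a b c d) (gnf n (s * (a * k)) (s * (b * k ^+ n.+1)) (s * c) (s * (d * k ^+ n))).
Proof.
move=> n0 D0 s0 k0; exists (gmob k 0 0 1).
have M : k * 1 - 0 * 0 != 0 by rewrite mulr1 mulr0 subr0.
split; first by exists k, 0, 0, 1.
have D0' : s * (a * k) * (s * (d * k ^+ n)) - s * (b * k ^+ n.+1) * (s * c) != 0.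
  rewrite (_ : _ - _ = s ^+ 2 * k ^+ n.+1 * (a * d - b * c)); last by rewrite exprS; ring.
  by rewrite !mulf_neq0 ?expf_neq0.
rewrite mob_nf // nf_diag ?mulr1 // expr1n !mulr1 !mul0r !mul1r !addr0 !add0r.
rewrite -(nf_scale n0 (k := s * k ^+ n)) ?mulf_neq0 ?expf_neq0 //.
  by rewrite exprS; congr gnf; ring.
rewrite (_ : _ - _ = k * (a * d - b * c)) ?mulf_neq0 //; ring.
Qed.

(** With t = a'/a and r = c/c', the constraints on a d and b c give d' = d/t and b' = r b. The
    rescaling by k = t r and s = 1/r then works as soon as t^(n+1) r^(n-1) = 1, which follows from
    the first term of Y if b is nonzero and from the second if d is. *)
Lemma nf_conj_generic m a b c d a' b' c' d' :
  a * d - b * c = 1 -> a' * d' - b' * c' = 1 -> b * c = b' * c' ->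
  a ^+ m.+3 * b ^+ m.+1 = a' ^+ m.+3 * b' ^+ m.+1 ->
  c ^+ m.+1 * d ^+ m.+3 = c' ^+ m.+1 * d' ^+ m.+3 ->
  a != 0 -> c != 0 ->
  gconj (gnf m.+2 a b c d) (gnf m.+2 a' b' c' d').
Proof.
move=> D1 D1' eX ea eb a0 c0.
have ead : a * d = a' * d' by rewrite -[a * d](subrK (b * c)) D1 eX -D1' subrK.
have D0 : a * d - b * c != 0 by rewrite D1 oner_eq0.
have bd0 : (b != 0) || (d != 0).
  apply: contraNT D0; rewrite negb_or !negbK => /andP[/eqP-> /eqP->].
  by rewrite mulr0 mul0r subrr.
have a'0 : a' != 0.
  have [bz|bz] := eqVneq b 0.
    apply: contra_eqN D1' => /eqP a'0; rewrite a'0 mul0r -eX bz mul0r subr0.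
    by rewrite eq_sym oner_eq0.
  apply: contra_eqN ea => /eqP->.
  by rewrite expr0n mul0r mulf_neq0 ?expf_neq0.
have c'0 : c' != 0.
  have [dz|dz] := eqVneq d 0.
    apply: contra_eqN D1' => /eqP c'0; rewrite c'0 mulr0 -ead dz mulr0 subr0.
    by rewrite eq_sym oner_eq0.
  apply: contra_eqN eb => /eqP->.
  by rewrite expr0n mul0r mulf_neq0 ?expf_neq0.
pose t := a' / a; pose r := c / c'.
have t0 : t != 0 by rewrite mulf_neq0 ?invr_eq0.
have r0 : r != 0 by rewrite mulf_neq0 ?invr_eq0.
have b'E : b' = b * r by rewrite /r mulrA eX mulfK.
have d'E : d' = d / t by apply: (mulfI a'0); rewrite -ead /t; field; rewrite a0.
have a'E : a' = t * a by rewrite divfK.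
have c'E : c' = c / r by rewrite /r; field; rewrite c0 c'0.
have key : t ^+ m.+3 * r ^+ m.+1 = 1.
  case/orP: bd0 => [b0|d0].
    apply: (mulfI (mulf_neq0 (expf_neq0 m.+3 a0) (expf_neq0 m.+1 b0))).
    by rewrite mulr1 [RHS]ea a'E b'E !exprMn; ring.
  apply: (mulIf (mulf_neq0 (expf_neq0 m.+1 c0) (expf_neq0 m.+3 d0))).
  rewrite mul1r [in LHS]eb c'E d'E !expr_div_n; field.
  by rewrite !expf_neq0.
have := nf_rescale (isT : (0 < m.+2)%N) D0 (s := r^-1) (k := t * r).
rewrite invr_eq0 r0 mulf_neq0 // => /(_ isT isT).
congr (gconj _ (gnf _ _ _ _ _)).
- by rewrite a'E; field.
- rewrite b'E exprMn (_ : r ^+ m.+3 = r ^+ m.+1 * r ^+ 2); last by rewrite -exprD addn2.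
  by rewrite [t ^+ _ * _]mulrA key mul1r; field.
- by rewrite c'E mulrC.
- apply: (mulfI t0); rewrite d'E [RHS]mulrC divfK // exprMn.
  rewrite (_ : t * _ = (t * t ^+ m.+2) * (r ^+ m.+2 / r) * d); last by field.
  by rewrite -exprS [r ^+ m.+2]exprSr mulfK // key mul1r.
Qed.

Lemma expM_eq0 x y i j : x != 0 -> x ^+ i * y ^+ j.+1 = 0 -> y = 0.
Proof.
move=> x0 /eqP; rewrite mulf_eq0 expf_eq0 (negPf x0) andbF /= expf_eq0.
by move=> /andP[_ /eqP].
Qed.

(** Once the terms of Y are matched, the generic case applies directly or after conjugation by 1/z.
    With determinant 1 there remain only b = c = 0 and a = d = 0, the maps conjugate to z^n and
    z^(-n), for which Y carries no information and the scaling factor is found by extracting a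
    root. *)
Lemma nf_conj_XY1 m a b c d a' b' c' d' :
  a * d - b * c = 1 -> a' * d' - b' * c' = 1 -> b * c = b' * c' ->
  a ^+ m.+3 * b ^+ m.+1 + c ^+ m.+1 * d ^+ m.+3 =
  a' ^+ m.+3 * b' ^+ m.+1 + c' ^+ m.+1 * d' ^+ m.+3 ->
  gconj (gnf m.+2 a b c d) (gnf m.+2 a' b' c' d').
Proof.
move=> D1 D1' eX eY.
have ead : a * d = a' * d' by rewrite -[a * d](subrK (b * c)) D1 eX -D1' subrK.
have D0 : a * d - b * c != 0 by rewrite D1 oner_eq0.
have D0' : a' * d' - b' * c' != 0 by rewrite D1' oner_eq0.
(* The two terms of Y have sum Y and product (a d)^(n+1) (b c)^(n-1), which X determines. They
   therefore agree with those of the other map up to order, and conjugation by 1/z exchanges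
   them. *)
wlog ea : a' b' c' d' D1' eX eY ead D0' / a ^+ m.+3 * b ^+ m.+1 = a' ^+ m.+3 * b' ^+ m.+1.
  move=> hw; set al := _ * _ in eY; set be := _ * _ in eY.
  set al' := _ * _ in eY; set be' := _ * _ in eY.
  have ep : al * be = al' * be'.
    rewrite /al /be /al' /be' (_ : _ * _ = (a * d) ^+ m.+3 * (b * c) ^+ m.+1); last by rewrite !exprMn; ring.
    by rewrite ead eX !exprMn; ring.
  have : (al - al') * (al - be') = 0.
    rewrite (_ : _ * _ = al ^+ 2 - al * (al' + be') + al' * be'); last by ring.
    by rewrite -eY -ep; ring.
  move/eqP; rewrite mulf_eq0 !subr_eq0 => /orP[]/eqP e; first exact: hw.
  apply: (gconj_trans _ (gconj_sym (nf_swap _ D0'))) => //.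
  apply: hw.
  - by rewrite -D1'; ring.
  - by rewrite eX mulrC.
  - by rewrite -/al -/be eY /al' /be' addrC; congr (_ + _); rewrite mulrC.
  - by rewrite ead mulrC.
  - by rewrite [d' * a']mulrC [c' * b']mulrC.
  - by rewrite -/al e /be' mulrC.
have eb : c ^+ m.+1 * d ^+ m.+3 = c' ^+ m.+1 * d' ^+ m.+3 by move: eY; rewrite ea => /addrI.
have [/andP[a0 c0]|ac] := boolP ((a != 0) && (c != 0)).
  exact: nf_conj_generic.
have [/andP[b0 d0]|bd] := boolP ((b != 0) && (d != 0)).
  apply: (gconj_trans (nf_swap _ D0)) => //.
  apply: (gconj_trans _ (gconj_sym (nf_swap _ D0'))) => //.
  apply: nf_conj_generic => //.
  - by rewrite -D1; ring.
  - by rewrite -D1'; ring.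
  - by rewrite mulrC eX mulrC.
  - by rewrite mulrC eb mulrC.
  - by rewrite mulrC ea mulrC.
have [bc0|bc0] := eqVneq (b * c) 0.
  have ad1 : a * d = 1 by rewrite -D1 bc0 subr0.
  have [a0 d0] : a != 0 /\ d != 0.
    by apply/andP; rewrite -negb_or -mulf_eq0 ad1 oner_eq0.
  move: ac bd; rewrite a0 d0 andbT /= !negbK => /eqP c0 /eqP b0.
  have [a'0 d'0] : a' != 0 /\ d' != 0.
    by apply/andP; rewrite -negb_or -mulf_eq0 -ead ad1 oner_eq0.
  move: ea eb; rewrite b0 c0 expr0n mulr0 mul0r => /esym/(expM_eq0 a'0) b'0.
  rewrite mulrC => /esym/(expM_eq0 d'0) c'0.
  (* With s = a'/(a k) the coefficient a is right, and d becomes a' d k^(n-1) / a, which has to be a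
     d / a'. *)
  pose k := m.+1.-root ((a / a') ^+ 2).
  have kE : k ^+ m.+1 = (a / a') ^+ 2 by rewrite rootCK.
  have k0 : k != 0.
    apply: contra_eqN kE => /eqP->.
    by rewrite expr0n eq_sym expf_neq0 // mulf_neq0 ?invr_eq0.
  have := nf_rescale (isT : (0 < m.+2)%N) D0 (s := a' / (a * k)) (k := k).
  rewrite k0 !mulf_neq0 ?invr_eq0 ?mulf_neq0 // => /(_ isT isT).
  rewrite b0 c0 b'0 c'0 !mul0r !mulr0; congr (gconj _ (gnf _ _ _ _ _)).
    by rewrite divfK ?mulf_neq0.
  rewrite exprS kE; have -> : d' = a * d / a' by rewrite ead mulrAC mulfV ?mul1r.
  by field; rewrite ?a0 ?k0 ?a'0.
have [b0 c0] : b != 0 /\ c != 0 by apply/andP; rewrite -negb_or -mulf_eq0.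
move: ac bd; rewrite c0 b0 andbT /= !negbK => /eqP a0 /eqP d0.
have [b'0 c'0] : b' != 0 /\ c' != 0.
  by apply/andP; rewrite -negb_or -mulf_eq0 -eX.
move: ea eb; rewrite a0 d0 expr0n mulr0 mul0r => + /esym/(expM_eq0 c'0) d'0.
rewrite mulrC => /esym/(expM_eq0 b'0) a'0.
(* With s = c'/c the coefficient c is right, and b becomes c' b k^(n+1) / c, which has to be b'. *)
pose k := m.+3.-root ((b' * c) / (b * c')).
have kE : k ^+ m.+3 = (b' * c) / (b * c') by rewrite rootCK.
have k0 : k != 0.
  by apply: contra_eqN kE => /eqP->; rewrite expr0n eq_sym !mulf_neq0 ?invr_eq0 ?mulf_neq0.
have := nf_rescale (isT : (0 < m.+2)%N) D0 (s := c' / c) (k := k).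
rewrite k0 mulf_neq0 ?invr_eq0 // => /(_ isT isT).
rewrite a0 d0 a'0 d'0 !mul0r !mulr0 kE; congr (gconj _ (gnf _ _ _ _ _)).
  by field; rewrite ?b0 ?c0 ?c'0.
by field; rewrite ?c0.
Qed.

Definition nfX a b c d := b * c / (a * d - b * c).

Definition nfY n a b c d :=
  (a ^+ n.+1 * b ^+ n.-1 + c ^+ n.-1 * d ^+ n.+1) / (a * d - b * c) ^+ n.

(** X and Y are homogeneous of degree 0 in the coefficients, so dividing these by a square root of
    the determinant reduces to determinant 1. *)
Lemma nf_conj_XY n a b c d a' b' c' d' : (1 < n)%N ->
  a * d - b * c != 0 -> a' * d' - b' * c' != 0 ->
  nfX a b c d = nfX a' b' c' d' -> nfY n a b c d = nfY n a' b' c' d' ->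
  gconj (gnf n a b c d) (gnf n a' b' c' d').
Proof.
case: n => [|[|m]] // _ D0 D0'; rewrite /nfX /nfY /= => eX eY.
have norm x : x != 0 -> exists k, k != 0 /\ k ^+ 2 = x^-1.
  move=> x0; exists (sqrtC x^-1); rewrite sqrtCK; split => //.
  by rewrite sqrtC_eq0 invr_eq0.
have [k [k0 kE]] := norm _ D0; have [k' [k'0 kE']] := norm _ D0'.
rewrite -(nf_scale _ k0 D0) // -(nf_scale _ k'0 D0') //.
have DE (l u v u' v' : F) : l ^+ 2 = (u * v - u' * v')^-1 -> u * v - u' * v' != 0 -> l * u * (l * v) - l * u' * (l * v') = 1.
  move=> lE nz; transitivity (l ^+ 2 * (u * v - u' * v')); first by ring.
  by rewrite lE mulVf.
have Yh (l u v w x : F) : (l * u) ^+ m.+3 * (l * v) ^+ m.+1 + (l * w) ^+ m.+1 * (l * x) ^+ m.+3 =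
    (u ^+ m.+3 * v ^+ m.+1 + w ^+ m.+1 * x ^+ m.+3) * (l ^+ 2) ^+ m.+2.
  by rewrite !exprMn !exprS; ring.
apply: nf_conj_XY1.
- exact: DE.
- exact: DE.
- transitivity (k ^+ 2 * (b * c)); first by ring.
  by rewrite kE mulrC eX -kE'; ring.
- by rewrite !Yh kE kE' !exprVn eY.
Qed.

End Invariants.

(** * Power sums of the fixed points *)

Section Vieta.
Variable F : numClosedFieldType.
Implicit Types (a b c d x y : F).

Lemma sum_cofactor_coef m e (t : 'I_m -> F) j :
  \sum_i (e *: \prod_(k | k != i) ('X - (t k)%:P))`_j =
  (e *: \prod_i ('X - (t i)%:P))`_j.+1 *+ j.+1.
Proof.
rewrite -coef_deriv derivZ -coef_sum -scaler_sumr.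
apply: (congr1 (fun p : {poly F} => (e *: p)`_j)).
elim: m t => [|m ih] t; first by rewrite !big_ord0 derivC.
rewrite big_ord_recl [in RHS]big_ord_recl derivM derivXsubC mul1r; congr (_ + _).
  by rewrite big_mkcond big_ord_recl /= mul1r; apply: eq_bigr => i _.
rewrite -ih mulr_sumr; apply: eq_bigr => i _.
rewrite big_mkcond big_ord_recl /=; congr (_ * _).
by rewrite -big_mkcond.
Qed.

Definition fixpoly n a b c d : {poly F} :=
  'X * (c *: 'X^n + d%:P) - (a *: 'X^n + b%:P).

Lemma coef_fixpoly m a b c d k : (fixpoly m.+2 a b c d)`_k =
  if k == m.+3 then c else if k == m.+2 then - a else
  if k == 1%N then d else if k == 0%N then - b else 0.
Proof.
have cX i : ('X^(m.+2) : {poly F})`_i = (i == m.+2)%:R by rewrite coefXn.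
rewrite /fixpoly; move: ('X^(m.+2) : {poly F}) cX => Xn cX.
rewrite !(coefB, coefD, coefXM, coefZ, coefC, cX).
case: k => [|k] /=; first by rewrite mulr0 !add0r.
rewrite !eqSS addr0; have [->|_] := eqVneq k m.+2.
  have -> : (m.+2 == m.+1) = false by apply/eqP; lia.
  by rewrite /= mulr1 mulr0 addr0 subr0.
have [->|_] := eqVneq k m.+1; first by rewrite /= mulr0 addr0 mulr1 sub0r.
by rewrite !mulr0 add0r subr0.
Qed.

(** Newton's identities, with n = m + 2. The polynomial has no terms of degree strictly between 1
    and n, so the power sums P_k satisfy c^k P_k = a^k for 0 < k < n, and d enters only at k = n. *)
Lemma power_sum m a b c d (t : 'I_m.+3 -> F) :
  fixpoly m.+2 a b c d = c *: \prod_i ('X - (t i)%:P) ->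
  c ^+ m.+2 * \sum_i t i ^+ m.+2 = a ^+ m.+2 - m.+2%:R * c ^+ m.+1 * d.
Proof.
(* The cofactors H / (X - t_i). Their coefficients follow by synthetic division from the top, and
   their sum is H'. *)
move=> HE; pose G i := c *: \prod_(k | k != i) ('X - (t k)%:P).
pose H := fixpoly m.+2 a b c d.
have GE i j : H`_j.+1 = (G i)`_j - t i * (G i)`_j.+1.
  have -> : H = G i * ('X - (t i)%:P).
    by rewrite /H HE /G (bigD1 i) //= -scalerAl mulrC.
  by rewrite mulrBr coefB coefMX /= coefMC mulrC.
have Gtop i j : (m.+2 < j)%N -> (G i)`_j = 0.
  move=> lt_mj; apply: nth_default; apply: leq_trans lt_mj.
  rewrite /G (leq_trans (size_scale_leq _ _)) // -big_filter size_prod_XsubC.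
  by rewrite size_filter -sum1_count sum1_card cardC1 card_ord.
have G0 i : (G i)`_m.+2 = c.
  by have := GE i m.+2; rewrite (Gtop i m.+3) // mulr0 subr0 coef_fixpoly eqxx => <-.
have Gk i k : (k <= m)%N -> (G i)`_(m.+1 - k) = t i ^+ k * (c * t i - a).
  elim: k => [|k ih] le_km.
    rewrite subn0 mul1r; have := GE i m.+1; rewrite G0 coef_fixpoly eqxx.
    rewrite (_ : m.+2 == m.+3 = false) => [e|]; last by apply/eqP; lia.
    by rewrite addrC mulrC e subrK.
  rewrite subSS; have := GE i (m - k)%N.
  rewrite -subSn ?(ltnW le_km) // ih ?(ltnW le_km) // coef_fixpoly.
  rewrite !ifF; try by apply/eqP; lia.
  by move/esym/eqP; rewrite subr_eq0 => /eqP->; rewrite exprS mulrA.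
have Gz i : (G i)`_0 = d + t i ^+ m.+1 * (c * t i - a).
  have := GE i 0%N; rewrite -{2}(subSnn m) Gk // coef_fixpoly /=.
  by move=> ->; rewrite exprS mulrA subrK.
pose P k := \sum_i t i ^+ k.
have sumG j : \sum_i (G i)`_j = H`_j.+1 *+ j.+1 by rewrite /H HE sum_cofactor_coef.
have sumk k : (k <= m)%N -> c * P k.+1 - a * P k = H`_(m.+2 - k) *+ (m.+2 - k).
  move=> le_km; rewrite subSn; last by lia.
  rewrite -sumG /P !mulr_sumr -sumrB; apply: eq_bigr => i _.
  by rewrite Gk // exprS; ring.
have Pk k : (k <= m)%N -> c ^+ k.+1 * P k.+1 = a ^+ k.+1.
  elim: k => [|k ih] le_km.
    have := sumk 0%N isT; rewrite subn0 coef_fixpoly eqxx.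
    rewrite (_ : m.+2 == m.+3 = false); last by apply/eqP; lia.
    rewrite [P 0%N](_ : _ = m.+3%:R); last first.
      by rewrite /P; under eq_bigr do rewrite expr0; rewrite sumr_const card_ord.
    move/eqP; rewrite subr_eq => /eqP e; rewrite !expr1 e.
    by rewrite mulNrn -[a *+ _]mulr_natr (_ : m.+3%:R = m.+2%:R + 1 :> F) ?mulrDr ?mulr1 ?addKr // -natr1.
  have := sumk k.+1 le_km; rewrite coef_fixpoly !ifF; try by apply/eqP; lia.
  rewrite mul0rn => /eqP; rewrite subr_eq0 => /eqP e.
  by rewrite exprSr -mulrA e mulrCA ih ?(ltnW le_km) // [in RHS]exprS.
have := sumG 0%N; rewrite coef_fixpoly /=.
have -> : \sum_i (G i)`_0 = m.+3%:R * d + (c * P m.+2 - a * P m.+1).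
  under eq_bigr do rewrite Gz; rewrite big_split /= sumr_const card_ord mulr_natl; congr (_ + _).
  by rewrite /P !mulr_sumr -sumrB; apply: eq_bigr => i _; rewrite !exprS; ring.
rewrite mulr1n => e.
have e2 : c * P m.+2 = a * P m.+1 - m.+2%:R * d.
  have n1 : m.+3%:R = m.+2%:R + 1 :> F by rewrite -natr1.
  rewrite n1 in e; move: (m.+2%:R : F) e => N e.
  rewrite (_ : c * P m.+2 = (N + 1) * d + (c * P m.+2 - a * P m.+1) - (N + 1) * d + a * P m.+1); last by ring.
  by rewrite e; ring.
rewrite -/(P m.+2) exprSr -mulrA e2 mulrBr mulrCA Pk // [in RHS]exprS; ring.
Qed.

End Vieta.

(** * Computation of sigma_n for a normal form *)

Section SigmaNormalForm.
Variable F : numClosedFieldType.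
Implicit Types (a b c d x y : F).

Definition gelem_sym (m k : nat) (t : 'I_m -> F) : F :=
  \sum_(A : {set 'I_m} | #|A| == k) \prod_(i in A) t i.

(** The subsets of n elements among n + 1 are the complements of the singletons. *)
Lemma elem_sym_penultimate n (t : 'I_n.+1 -> F) :
  gelem_sym n t = \sum_i \prod_(j | j != i) t j.
Proof.
pose h (i : 'I_n.+1) := [set~ i]%SET.
rewrite /gelem_sym (reindex_onto h (fun A => odflt ord0 [pick x in ~: A]%SET)) /=.
  rewrite (eq_bigl xpredT) => [|i]; last first.
    rewrite /h cardsC1 card_ord eqxx /=; apply/eqP; rewrite finset.setCK.
    case: pickP => [x|/(_ i)]; rewrite !inE ?eqxx //.
    by move/eqP.
  by apply: eq_bigr => i _; apply: eq_bigl => j; rewrite !inE.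
move=> A /eqP cA; rewrite /h.
have : #|~: A|%SET == 1%N by rewrite cardsCs finset.setCK card_ord cA subSnn.
move=> /cards1P[x xE]; rewrite xE; case: pickP => [y|/(_ x)]; rewrite !inE ?eqxx //.
by move=> /eqP-> /=; rewrite -xE finset.setCK.
Qed.

Definition nf_mult n a b c d x :=
  n%:R * x ^+ n.-1 * (a * d - b * c) / (c * x ^+ n + d) ^+ 2.

Definition nf_sigma n a b c d := n%:R ^+ n *
  (nfY n a b c d + nfX a b c d ^+ n.-1 * (2 * nfX a b c d + 1 - n%:R)).

Section Roots.
Variables (m : nat) (a b c d : F) (t : 'I_m.+3 -> F).
Local Notation n := m.+2.
Local Notation D := (a * d - b * c).
Local Notation splits :=
  (fixpoly m.+2 a b c d = c *: \prod_i ('X - (t i)%:P)).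

Lemma fixpolyE x : splits ->
  x * (c * x ^+ n + d) - (a * x ^+ n + b) = c * \prod_i (x - t i).
Proof.
move=> /(congr1 (horner^~ x)); rewrite hornerZ horner_prod /fixpoly.
rewrite -!mul_polyC !(hornerXn, hornerD, hornerN, hornerM, hornerX, hornerC) => ->.
by congr (_ * _); apply: eq_bigr => i _; rewrite !hornerE.
Qed.

Lemma fixpoly_root i : splits -> t i * (c * t i ^+ n + d) = a * t i ^+ n + b.
Proof.
by move=> HE; apply/eqP; rewrite -subr_eq0 fixpolyE // (bigD1 i) //= subrr mul0r mulr0.
Qed.

(** At a fixed point t, up to the determinant, a - c t is the inverse of the denominator. This makes
    the multipliers polynomial in t, so that their product can be read off from values of the
    fixed-point polynomial. *)
Lemma denom_root i : splits -> (a - c * t i) * (c * t i ^+ n + d) = D.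
Proof. by move=> HE; rewrite mulrBl -mulrA fixpoly_root //; ring. Qed.

Lemma denom_neq0 i : D != 0 -> splits -> c * t i ^+ n + d != 0.
Proof.
by move=> D0 HE; apply: contraNneq D0 => e; rewrite -(denom_root i HE) e mulr0.
Qed.

Lemma nf_multE i : D != 0 -> splits ->
  nf_mult n a b c d (t i) = n%:R / D * (t i ^+ m.+1 * (a - c * t i) ^+ 2).
Proof.
move=> D0 HE; have q0 := denom_neq0 i D0 HE; rewrite /nf_mult [n.-1]/=.
apply: (canLR (mulfK (expf_neq0 2 q0))).
transitivity (n%:R * t i ^+ m.+1 / D * ((a - c * t i) * (c * t i ^+ n + d)) ^+ 2).
  by rewrite denom_root //; move: (t i ^+ _) D0 => y; move: D => D' D0; field.
by move: (t i ^+ m.+1) (t i ^+ n) => y z; ring.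
Qed.

Lemma prod_oppr_roots : splits -> c * \prod_i (- t i) = - b.
Proof.
move=> HE; have := fixpolyE 0 HE.
rewrite expr0n mulr0n mul0r !mulr0 !add0r => ->.
by congr (_ * _); apply: eq_bigr => i _; rewrite sub0r.
Qed.

Lemma prod_roots : splits -> c * \prod_i t i = (-1) ^+ n * b.
Proof.
move=> /prod_oppr_roots; under eq_bigr do rewrite -mulN1r.
rewrite big_split /= prodr_const card_ord exprS => e.
have := sqrr_sign F n; move: ((-1) ^+ n) e => s e s2.
transitivity (s ^+ 2 * (c * \prod_i t i)); first by rewrite s2 mul1r.
transitivity (- s * (c * (-1 * s * \prod_i t i))); first by move: (\prod_i t i) => P; ring.
by rewrite e mulrNN.
Qed.

(** The fixed-point polynomial at a/c, where it takes the value (a d - b c)/c. *)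
Lemma prod_denoms : c != 0 -> splits -> \prod_i (a - c * t i) = c ^+ m.+1 * D.
Proof.
move=> c0 HE.
have cE i : a - c * t i = c * (a / c - t i) by rewrite mulrBr mulrCA divff ?mulr1.
under eq_bigr do rewrite cE.
rewrite big_split /= prodr_const card_ord.
have := fixpolyE (a / c) HE; set P := \prod_i _ => e.
have <- : c * P * c = D by rewrite -e; move: (_ ^+ n) => y; field.
by rewrite !exprS; ring.
Qed.

Lemma prod_mults : D != 0 -> c != 0 -> splits ->
  \prod_i nf_mult n a b c d (t i) = n%:R ^+ n.+1 * nfX a b c d ^+ m.+1.
Proof.
move=> D0 c0 HE.
under eq_bigr do rewrite nf_multE //.
rewrite big_split /= prodr_const card_ord big_split /= !prodrXl prod_denoms //.
have -> : \prod_i t i = (-1) ^+ n * b / c.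
  by rewrite -prod_roots // mulrAC divff ?mul1r.
(* The exponent n (n - 1) is even. *)
have : ((-1) ^+ n) ^+ m.+1 = 1 :> F.
  by rewrite -exprM -signr_odd oddM /= negbK; case: (odd m).
move: ((-1) ^+ n) => s s2; rewrite /nfX; move: D D0 => D' D0.
rewrite !expr_div_n !exprMn s2 mul1r !exprS.
have := expf_neq0 m c0; have := expf_neq0 m D0.
move: (c ^+ m) (D' ^+ m) (b ^+ m) (n%:R ^+ m) => x y z v y0 x0.
by field; rewrite ?D0 ?c0 ?x0 ?y0.
Qed.

End Roots.

(** The inverses of the fixed points are the fixed points of the conjugate by 1/z, whose
    coefficients are d, c, b, a. *)
Lemma sum_inv_roots m a b c d (t : 'I_m.+3 -> F) : b != 0 ->
  fixpoly m.+2 a b c d = c *: \prod_i ('X - (t i)%:P) -> c != 0 ->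
  b ^+ m.+2 * \sum_i (t i)^-1 ^+ m.+2 = d ^+ m.+2 - m.+2%:R * b ^+ m.+1 * a.
Proof.
move=> b0 HE c0; have pr := prod_roots HE; have fE x := fixpolyE x HE.
have t0 i : t i != 0.
  apply: contra_eqN pr => /eqP ti; rewrite (bigD1 i) //= ti mul0r mulr0.
  by rewrite eq_sym mulf_neq0 ?signr_eq0.
apply: (@power_sum _ m d c b a (fun i => (t i)^-1)); apply: (@poly_eq_nz _ _ _ 0) => x x0.
have cb := prod_oppr_roots HE.
rewrite hornerZ horner_prod /fixpoly.
rewrite -!mul_polyC !(hornerXn, hornerD, hornerN, hornerM, hornerX, hornerC).
under eq_bigr do rewrite hornerXsubC.
have := fE x^-1.
have -> : \prod_i (x^-1 - t i) = \prod_i (x^-1 * (- t i)) * \prod_i (x - (t i)^-1).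
  by rewrite -big_split; apply: eq_bigr => i _ /=; field; rewrite x0 t0.
rewrite big_split /= prodr_const card_ord => e.
have : b * \prod_i (x - (t i)^-1) = - (x ^+ m.+3 * (c * (x^-1 ^+ m.+3 * (\prod_i - t i) * \prod_i (x - (t i)^-1)))).
  rewrite exprVn (_ : x ^+ m.+3 * _ = c * \prod_i (- t i) * \prod_i (x - (t i)^-1)).
    by rewrite cb; ring.
  by move: (x ^+ m.+3) (expf_neq0 m.+3 x0) => y y0; field.
move=> ->; rewrite -e !exprVn [x ^+ m.+3]exprS.
by move: (x ^+ m.+2) (expf_neq0 m.+2 x0) => y y0; field; rewrite y0 x0.
Qed.

(** As c is nonzero, every fixed point is finite. If b is nonzero too, no multiplier vanishes, and
    sigma_n is their product times the sum of their inverses; each inverse is an affine combination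
    of t^n and t^(-n), so the two power sums suffice. If b = 0, the fixed point 0 has multiplier 0
    and only the product over the other fixed points survives. *)
Lemma sigma_roots m a b c d (t : 'I_m.+3 -> F) :
  a * d - b * c != 0 -> c != 0 ->
  fixpoly m.+2 a b c d = c *: \prod_i ('X - (t i)%:P) ->
  gelem_sym m.+2 (fun i => nf_mult m.+2 a b c d (t i)) = nf_sigma m.+2 a b c d.
Proof.
move=> D0 c0 HE; rewrite elem_sym_penultimate; set n := m.+2; set D := a * d - b * c in D0.
have fr i := fixpoly_root i HE; have q0 i := denom_neq0 i D0 HE.
have pm := prod_mults D0 c0 HE; have pr := prod_roots HE.
have [b0|b0] := eqVneq b 0.
  have [i0 ti0] : exists i0, t i0 = 0.
    move: pr; rewrite b0 mulr0 => /eqP; rewrite mulf_eq0 (negPf c0) /=.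
    by move=> /prodf_eq0[i _ /eqP ti]; exists i.
  have [a0 d0] : a != 0 /\ d != 0.
    by apply/andP; rewrite -negb_or -mulf_eq0; move: D0; rewrite /D b0 mul0r subr0.
  rewrite (bigD1 i0) //= [X in _ + X]big1 ?addr0; last first.
    move=> i ii0; rewrite (bigD1 i0) 1?eq_sym //= ti0 /nf_mult.
    by rewrite expr0n !(mulr0, mul0r).
  under eq_bigr do rewrite (nf_multE _ D0 HE).
  rewrite big_split /= prodr_const cardC1 card_ord big_split /= !prodrXl.
  have -> : \prod_(i < m.+3 | i != i0) (a - c * t i) = c ^+ m.+1 * d.
    apply: (mulfI a0); have := prod_denoms c0 HE.
    by rewrite (bigD1 i0) //= ti0 mulr0 subr0 => ->; rewrite b0 mul0r subr0; ring.
  have -> : \prod_(i < m.+3 | i != i0) t i = (-1) ^+ n * d / c.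
    apply: (mulfI c0); rewrite [RHS]mulrC divfK //.
    (* Dividing by the factor X of the fixed point 0 leaves a polynomial with value d at 0, which
       gives the product of the other roots. *)
    have : fixpoly n a b c d = 'X * (c *: 'X^(m.+2) - a *: 'X^(m.+1) + d%:P).
      by rewrite /fixpoly b0 polyC0 addr0 -!mul_polyC [in 'X^n]exprS; ring.
    have X0 : ('X : {poly F}) != 0 by rewrite polyX_eq0.
    rewrite HE (bigD1 i0) //= ti0 subr0 scalerAr => /(mulfI X0).
    move=> /(congr1 (horner^~ 0)); rewrite hornerZ horner_prod.
    rewrite !(hornerXn, hornerD, hornerN, hornerC, hornerZ) !expr0n mulr0n.
    rewrite !mulr0 subr0 add0r.
    under eq_bigr do rewrite hornerXsubC sub0r -mulN1r.
    rewrite big_split /= prodr_const cardC1 card_ord -/n => e.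
    have := sqrr_sign F n; move: ((-1) ^+ n) e => u e u2.
    move: (\prod_(i < m.+3 | i != i0) t i) e => P e.
    transitivity (u ^+ 2 * (c * P)); first by rewrite u2 mul1r.
    by rewrite -e; ring.
  have : ((-1) ^+ n) ^+ m.+1 = 1 :> F.
    by rewrite -exprM -signr_odd oddM /n /= negbK; case: (odd m).
  move: ((-1) ^+ n) => s s2.
  rewrite /nf_sigma /nfX /nfY b0 /n !mul0r !subr0 [0 ^+ _.-1]expr0n mulr0n.
  rewrite !mulr0 mul0r add0r addr0 !expr_div_n !exprMn s2 mul1r.
  rewrite [_.-1]/= !exprS; have := expf_neq0 m c0; have := expf_neq0 m a0.
  have := expf_neq0 m d0.
  move: (c ^+ m) (a ^+ m) (d ^+ m) (m.+2%:R ^+ m) => x y z v z0 y0 x0.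
  by field; rewrite ?a0 ?c0 ?d0 ?x0 ?y0 ?z0.
have t0 i : t i != 0.
  apply: contra_eqN pr => /eqP ti; rewrite (bigD1 i) //= ti mul0r mulr0.
  by rewrite eq_sym mulf_neq0 ?signr_eq0.
have n0 : n%:R != 0 :> F by rewrite pnatr_eq0.
have m0 i : nf_mult n a b c d (t i) != 0.
  by rewrite /nf_mult !mulf_neq0 ?invr_eq0 ?expf_neq0.
have invE i : (nf_mult n a b c d (t i))^-1 =
    (a * c * t i ^+ n + b * d * (t i)^-1 ^+ n + (a * d + b * c)) / (n%:R * D).
  have e : t i ^+ m.+1 * (a * t i ^+ n + b) = t i ^+ n * (c * t i ^+ n + d).
    by rewrite -fr mulrA -exprSr.
  rewrite /nf_mult -/D invf_div exprVn.
  have e2 : (c * t i ^+ n + d) ^+ 2 / t i ^+ m.+1 = (c * t i ^+ n + d) * (a * t i ^+ n + b) / t i ^+ n.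
    apply/eqP; rewrite eqr_div ?expf_neq0 //; apply/eqP.
    by rewrite expr2 -!mulrA [(_ + b) * _]mulrC e; congr (_ * _); exact: mulrC.
  rewrite (_ : _ / _ = (c * t i ^+ n + d) ^+ 2 / t i ^+ m.+1 / (n%:R * D)); last first.
    by rewrite [n.-1]/=; field; rewrite D0 n0 expf_neq0.
  by rewrite e2; field; rewrite D0 n0 expf_neq0.
have pE i : \prod_(j | j != i) nf_mult n a b c d (t j) =
    n%:R ^+ n.+1 * nfX a b c d ^+ m.+1 * (nf_mult n a b c d (t i))^-1.
  by apply: (mulfI (m0 i)); move: pm; rewrite (bigD1 i) //= => ->; rewrite mulrCA divff ?mulr1.
rewrite (eq_bigr _ (fun i _ => pE i)) -mulr_sumr (eq_bigr _ (fun i _ => invE i)).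
rewrite -mulr_suml big_split /= sumr_const card_ord big_split /= -!mulr_sumr.
have := power_sum HE; have := sum_inv_roots b0 HE c0.
rewrite -/n; set S1 := \sum_i t i ^+ n; set S2 := \sum_i _ => e2 e1.
have -> : S1 = (a ^+ n - n%:R * c ^+ m.+1 * d) / c ^+ n by rewrite -e1 mulrAC divff ?mul1r ?expf_neq0.
have -> : S2 = (d ^+ n - n%:R * b ^+ m.+1 * a) / b ^+ n by rewrite -e2 mulrAC divff ?mul1r ?expf_neq0.
rewrite /nf_sigma /nfX /nfY -/D -[(a * d + b * c) *+ _]mulr_natl -[n.+1%:R]natr1.
rewrite [n.-1]/= !expr_div_n !exprMn /n; move: n0 e1 e2 => n0 _ _.
have N0 : m.+2%:R != 0 :> F by [].
rewrite [m.+2%:R ^+ m.+3]exprS; move: (m.+2%:R ^+ m.+2 : F) (m.+2%:R : F) N0 => N' N N0.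
rewrite ![_ ^+ m.+3]exprS ![_ ^+ m.+2]exprS.
have := expf_neq0 m.+1 b0; have := expf_neq0 m.+1 c0; have := expf_neq0 m.+1 D0.
move: (b ^+ m.+1) (c ^+ m.+1) (D ^+ m.+1) (a ^+ m.+1) (d ^+ m.+1) => B' C' D' A' E' D'0 C'0 B'0.
rewrite /D in D0 *.
by field; rewrite ?D'0 ?C'0 ?B'0 ?N0 ?D0 ?b0 ?c0.
Qed.

End SigmaNormalForm.

(** * Fixed points with multiplicity and invariance of sigma_n *)

Section FixedPoints.
Variable F : numClosedFieldType.
Implicit Types (a b c d x y w : F) (p q : {poly F}) (z : option F).

Definition gfix_mult (n : nat) p q z : nat :=
  match z with
  | Some w => mup w ('X * q - p)
  | None => (n.+1 - (size ('X * q - p)%R).-1)%N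
  end.

Lemma size_fix p q : (size ('X * q - p)%R <= (rdeg p q).+2)%N.
Proof.
rewrite (leq_trans (size_polyD _ _)) // geq_max size_polyN.
rewrite (leq_trans (size_rdegl p q)) // (leq_trans (size_polyMleq _ _)) //.
by rewrite size_polyX !ltnS size_rdegr.
Qed.

Lemma coef_fix p q : ('X * q - p)`_(rdeg p q).+1 = q`_(rdeg p q).
Proof. by rewrite coefB coefXM /= [p`__]nth_default ?size_rdegl // subr0. Qed.

Lemma fix_neq0 p q : coprimep p q -> (1 < rdeg p q)%N -> 'X * q - p != 0.
Proof.
move=> cpq n1; apply: contraTneq n1 => /eqP; rewrite subr_eq0 => /eqP e.
have sq : size q = 1%N.
  apply/eqP; rewrite -coprimepp; apply: coprimep_dvdr cpq.
  by rewrite -e dvdp_mulIr.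
have : (size p <= 2)%N.
  by rewrite -e (leq_trans (size_polyMleq _ _)) // size_polyX sq.
by rewrite /rdeg sq; move: (size p) => k; rewrite -leqNgt; lia.
Qed.

Lemma fix_mult_gt0 p q z : coprimep p q -> (1 < rdeg p q)%N ->
  (0 < gfix_mult (rdeg p q) p q z)%N = (gratmap p q z == z).
Proof.
move=> cpq n1; have F0 := fix_neq0 cpq n1; case: z => [w|] /=.
  rewrite -XsubC_dvd // dvdp_XsubCl /root !hornerE subr_eq0.
  have := coprime_nz2 w cpq; rewrite /nz2; have [->|q0] := eqVneq q.[w] 0.
    by rewrite mulr0 eq_sym orbF => /negPf ->.
  move=> _; rewrite (inj_eq Some_inj) -[RHS](inj_eq (mulIf q0)) divfK //.
rewrite subn_gt0 -/(rdeg p q); set n := rdeg p q.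
have -> : ((size ('X * q - p)%R).-1 < n.+1)%N = (q`_n == 0).
  rewrite -coef_fix -/n; apply/idP/eqP => [lt_s|e].
    by rewrite nth_default //; exact: leq_trans (leqSpred _) lt_s.
  have := size_fix p q; rewrite -/n leq_eqVlt => /orP[/eqP s|]; last first.
    by rewrite ltnS ltnS -subn1 leq_subLR add1n.
  by move: F0; rewrite -lead_coef_eq0 lead_coefE s /= e eqxx.
by case: eqP.
Qed.

(** The factor that z contributes to the fixed-point polynomial: a fixed point at infinity only
    lowers the degree. *)
Definition lin z : {poly F} := if z is Some u then 'X - u%:P else 1.

Lemma count_pmap_id (l : seq (option F)) u :
  count_mem u (pmap id l) = count_mem (Some u) l.
Proof. by elim: l => [|[v|] l ih] //=; rewrite ih. Qed.

Lemma prod_lin (l : seq (option F)) :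
  \prod_(z <- l) lin z = \prod_(u <- pmap id l) ('X - u%:P).
Proof.
elim: l => [|[v|] l ih] /=; first by rewrite !big_nil.
  by rewrite !big_cons ih.
by rewrite big_cons ih mul1r.
Qed.

Lemma fix_split n p q (l : seq (option F)) : 'X * q - p != 0 ->
  (forall z, count_mem z l = gfix_mult n p q z) ->
  'X * q - p = lead_coef ('X * q - p) *: \prod_(z <- l) lin z.
Proof.
move=> F0 cl; have [rs rsE] := closed_field_poly_normal ('X * q - p).
rewrite {1}rsE prod_lin; congr (_ *: _); apply: perm_big.
apply/allP => u _ /=; apply/eqP; rewrite count_pmap_id cl /= [in RHS]rsE.
by rewrite mup_neq0_scale ?lead_coef_eq0 // mu_prod_XsubC.
Qed.

Lemma fixed_points_exist p q : coprimep p q -> (1 < rdeg p q)%N ->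
  exists l : (rdeg p q).+1.-tuple (option F),
    forall z, count_mem z l = gfix_mult (rdeg p q) p q z.
Proof.
move=> cpq n1; have F0 := fix_neq0 cpq n1.
have [rs rsE] := closed_field_poly_normal ('X * q - p); set n := rdeg p q.
have srs : size ('X * q - p)%R = (size rs).+1.
  by rewrite rsE size_scale ?lead_coef_eq0 // size_prod_XsubC.
have le_rs : (size rs <= n.+1)%N by rewrite -ltnS -srs; exact: size_fix.
(* The degree missing from n + 1 is the multiplicity of infinity. *)
have sl : size (map Some rs ++ nseq (n.+1 - size rs) None) == n.+1.
  by rewrite size_cat size_map size_nseq subnKC.
exists (Tuple sl) => -[w|] /=; rewrite count_cat count_nseq count_map /=.
  rewrite mul0n addn0 [in RHS]rsE mup_neq0_scale ?lead_coef_eq0 // mu_prod_XsubC.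
  by apply: eq_count => u /=; rewrite (inj_eq Some_inj).
by rewrite srs /= mul1n (eq_count (a2 := pred0)) // count_pred0.
Qed.

(** Uniqueness of lowest terms: from p Q = P q and coprimality P is a multiple of p, and the degree
    bound makes the cofactor constant. The argument is run on whichever of p, q attains degree n. *)
Lemma rat_proportional p q (P Q : {poly F}) n : coprimep p q -> rdeg p q = n ->
  (size P <= n.+1)%N -> (size Q <= n.+1)%N -> nz2 P.[0] Q.[0] ->
  (forall w, hpt p.[w] q.[w] = hpt P.[w] Q.[w]) ->
  exists2 k, k != 0 & P = k *: p /\ Q = k *: q.
Proof.
move=> cpq dn sP sQ PQ e.
have E : p * Q = P * q.
  apply/eqP; rewrite -subr_eq0; apply/eqP; apply: poly_all0 => w.
  by rewrite !hornerE (hpt_cross (e w)) subrr.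
have lz := lead_nz2 cpq; rewrite dn in lz.
suff [k [eP eQ]] : exists k, P = k *: p /\ Q = k *: q.
  exists k => //; apply: contraTneq PQ => k0.
  by rewrite eP eQ k0 !scale0r !horner0 /nz2 eqxx.
have gen p1 q1 (P1 Q1 : {poly F}) : coprimep p1 q1 -> p1`_n != 0 -> (size P1 <= n.+1)%N ->
    p1 * Q1 = P1 * q1 -> exists k, P1 = k *: p1 /\ Q1 = k *: q1.
  move=> c1 p1n sP1 E1; have p10 : p1 != 0 by apply: contraNneq p1n => ->; rewrite coef0.
  have : p1 %| P1 by rewrite -(Gauss_dvdpl _ c1) -E1 dvdp_mulIl.
  case/dvdpP => K KE; have [P0|P0] := eqVneq P1 0.
    exists 0; rewrite !scale0r P0; split => //.
    by apply: (mulfI p10); rewrite E1 P0 mulr0 mul0r.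
  have K0 : K != 0 by apply: contraNneq P0 => K0; rewrite KE K0 mul0r.
  have sK : (size K <= 1)%N.
    have : (n < size p1)%N by rewrite ltnNge; apply: contra p1n => /leq_sizeP/(_ n (leqnn _)) ->.
    have arith s1 s2 : ((s1 + s2).-1 <= n.+1 -> n < s2 -> s1 <= 1)%N by lia.
    by move=> lt_n; move: sP1; rewrite KE size_mul // => /arith; apply.
  exists K`_0; rewrite -!mul_polyC -(size1_polyC sK) -KE; split => //.
  by apply: (mulfI p10); rewrite E1 KE; ring.
case/orP: lz => lz; first exact: gen.
have cqp : coprimep q p by rewrite coprimep_sym.
have E' : q * P = Q * p by rewrite mulrC -E mulrC.
by have [k [eQ eP]] := gen q p Q P cqp lz sQ E'; exists k.
Qed.

Lemma coprime_lin a b c d p q : coprimep p q -> a * d - b * c != 0 ->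
  coprimep (a *: p + b *: q) (c *: p + d *: q).
Proof.
move=> cpq D0; set P := _ + _; set Q := c *: p + _.
have pE : (a * d - b * c) *: p = d *: P - b *: Q.
  by rewrite /P /Q -!mul_polyC polyCB !polyCM; ring.
have qE : (a * d - b * c) *: q = a *: Q - c *: P.
  by rewrite /P /Q -!mul_polyC polyCB !polyCM; ring.
apply/coprimepP => r rP rQ; move/coprimepP: cpq; apply.
  by rewrite -(dvdpZr _ _ D0) pE dvdp_sub // -mul_polyC dvdp_mull.
by rewrite -(dvdpZr _ _ D0) qE dvdp_sub // -mul_polyC dvdp_mull.
Qed.

Lemma rdeg_lin a b c d p q : coprimep p q -> a * d - b * c != 0 ->
  rdeg (a *: p + b *: q) (c *: p + d *: q) = rdeg p q.
Proof.
move=> cpq D0; set n := rdeg p q; have := nz2_lin D0 (lead_nz2 cpq); rewrite -/n => nz.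
have le_size u v : (size (u *: p + v *: q)%R <= n.+1)%N.
  rewrite (leq_trans (size_polyD _ _)) // geq_max.
  by rewrite !(leq_trans (size_scale_leq _ _)) ?size_rdegl ?size_rdegr.
have gt_size u v : u * p`_n + v * q`_n != 0 -> (n < size (u *: p + v *: q)%R)%N.
  move=> h; rewrite ltnNge; apply: contra h => /leq_sizeP/(_ n (leqnn _)).
  by rewrite coefD !coefZ => ->.
rewrite /rdeg (_ : maxn _ _ = n.+1) //; apply/eqP.
rewrite eqn_leq geq_max !le_size leq_max /=.
by case/orP: nz => /gt_size ->; rewrite ?orbT.
Qed.

Lemma size_lin_expn a b n : (size ((a *: 'X + b%:P) ^+ n)%R <= n.+1)%N.
Proof.
rewrite (leq_trans (size_poly_exp_leq _ _)) // ltnS.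
have := @size_nf F 1 a b; rewrite expr1; case: (size _) => [|[|[|s]]] //= _; lia.
Qed.

(** Multiplicities are transported globally. With mu = U/V, the conjugacy relation lifts to
    polynomials, and U Q2 - V P2 is a constant times X q - p. Substituting the inverse of mu turns
    the left-hand side into the fixed-point polynomial of the normal form, up to powers of the
    denominator, and each linear factor at a fixed point into one at its image. *)
Lemma conj_fixpoly m p q a b c d mu (l : m.+3.-tuple (option F)) :
  coprimep p q -> rdeg p q = m.+2 -> a * d - b * c != 0 -> c != 0 ->
  gmobius mu -> mu \o gratmap p q = gnf m.+2 a b c d \o mu ->
  (forall z, count_mem z l = gfix_mult m.+2 p q z) ->
  exists t : 'I_m.+3 -> F, (forall i, mu (tnth l i) = Some (t i)) /\
    fixpoly m.+2 a b c d = c *: \prod_i ('X - (t i)%:P).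
Proof.
move=> cpq dn D0 c0 mmu e cl; set n := m.+2 in dn e cl *.
have n1 : (1 < rdeg p q)%N by rewrite dn.
have ac := det_nz2 D0.
have lfix i : gratmap p q (tnth l i) = tnth l i.
  apply/eqP; rewrite -fix_mult_gt0 // dn -cl -has_count has_pred1.
  exact: mem_tnth.
have mufix i : gnf n a b c d (mu (tnth l i)) = mu (tnth l i).
  by rewrite -[LHS]/((gnf n a b c d \o mu) _) -e /= lfix.
(* Since c is nonzero, infinity is not fixed, so every image of a fixed point is finite. *)
have NN : gnf n a b c d None <> None.
  rewrite hptN nf_hpt /nz2 ?oner_eq0 // expr1n expr0n !mulr1 mulr0n !mulr0 !addr0.
  by move/hpt_cross/eqP; rewrite mulr0 mul1r eq_sym (negPf c0).
pose t i := odflt 0 (mu (tnth l i)).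
have tE i : mu (tnth l i) = Some (t i).
  by rewrite /t; have := mufix i; case: (mu _) => // /NN.
exists t; split => //.
have [A [B [C [E [M0 muE]]]]] := mmu; have AC := det_nz2 M0.
pose U := A *: 'X + B%:P; pose V := C *: 'X + E%:P.
pose P2 := a *: U ^+ n + b *: V ^+ n; pose Q2 := c *: U ^+ n + d *: V ^+ n.
have UE w : U.[w] = A * w + B by rewrite /U hornerD hornerZ hornerX hornerC.
have VE w : V.[w] = C * w + E by rewrite /V hornerD hornerZ hornerX hornerC.
have PE w : P2.[w] = a * U.[w] ^+ n + b * V.[w] ^+ n.
  by rewrite /P2 hornerD !hornerZ !horner_exp.
have QE w : Q2.[w] = c * U.[w] ^+ n + d * V.[w] ^+ n.
  by rewrite /Q2 hornerD !hornerZ !horner_exp.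
have UVw w : nz2 U.[w] V.[w].
  have := nz2_lin M0 (x := w) (y := 1); rewrite /nz2 oner_eq0 orbT => /(_ isT).
  by rewrite !mulr1 UE VE.
have UVn w : nz2 (U.[w] ^+ n) (V.[w] ^+ n).
  by have := UVw w; rewrite /nz2 !expf_eq0 /=.
have [k k0 [kP kQ]] : exists2 k, k != 0 &
    P2 = k *: (A *: p + B *: q) /\ Q2 = k *: (C *: p + E *: q).
  apply: (@rat_proportional _ _ _ _ n).
  - exact: coprime_lin.
  - by rewrite rdeg_lin.
  - rewrite (leq_trans (size_polyD _ _)) // geq_max.
    by rewrite !(leq_trans (size_scale_leq _ _)) ?size_lin_expn.
  - rewrite (leq_trans (size_polyD _ _)) // geq_max.
    by rewrite !(leq_trans (size_scale_leq _ _)) ?size_lin_expn.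
  - by rewrite PE QE; exact: nz2_lin D0 (UVn 0).
  move=> w; have L u v : (u *: p + v *: q).[w] = u * p.[w] + v * q.[w].
    by rewrite hornerD !hornerZ.
  have : mu (gratmap p q (Some w)) = gnf n a b c d (mu (Some w)).
    exact: (congr1 (fun f => f (Some w)) e).
  rewrite !L PE QE muE [Some w]hptS.
  have w1 : nz2 w 1 by rewrite /nz2 oner_eq0 orbT.
  rewrite mob_hpt // ratmap_hpt // !homogS mob_hpt //; last exact: coprime_nz2.
  rewrite nf_hpt //; last by have := UVw w; rewrite UE VE !mulr1.
  by move=> ->; rewrite UE VE !mulr1.
have GE : U * Q2 - V * P2 = (k * (A * E - B * C)) *: ('X * q - p).
  rewrite kP kQ /U /V -!mul_polyC polyCM polyCB !polyCM; ring.
clearbody U V P2 Q2.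
have Fx0 := fix_neq0 cpq n1.
have := fix_split Fx0 cl; set lc := lead_coef _ => FxE.
have lc0 : lc != 0 by rewrite lead_coef_eq0.
pose De := A * E - B * C.
(* The constant by which the linear factor at z changes under the substitution. *)
pose K z := if z is Some u then C * u + E else - C.
have KP i : K (tnth l i) != 0 /\ forall x, A - C * x != 0 ->
    (A - C * x) * (lin (tnth l i)).[(E * x - B) / (A - C * x)] =
    K (tnth l i) * (x - t i).
  have := tE i; rewrite muE; case: (tnth l i) => [u|]; rewrite /K /lin.
    rewrite hptS mob_hpt ?mulr1 ?/nz2 ?oner_eq0 ?orbT // => h.
    have V0 : C * u + E != 0.
      by apply: contra_eqN h => /eqP V0; rewrite /hpt V0 eqxx.
    move: h; rewrite /hpt (negPf V0) => -[<-]; split => // x x0.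
    by rewrite !hornerE; field; rewrite ?V0 ?x0.
  rewrite hptN mob_hpt ?mulr1 ?/nz2 ?oner_eq0 // !mulr0 !addr0 => h.
  have C0 : C != 0 by apply: contra_eqN h => /eqP C0; rewrite /hpt C0 eqxx.
  move: h; rewrite /hpt (negPf C0) => -[<-]; rewrite oppr_eq0; split => // x x0.
  by rewrite hornerE; field; rewrite ?C0.
pose cst := k * De * lc * (\prod_i K (tnth l i)) / De ^+ n.+1.
have HE : fixpoly n a b c d = cst *: \prod_i ('X - (t i)%:P).
  (* The point A/C is where the inverse of mu has its pole. If C = 0 the quotient is 0 by convention
     and an innocuous point is left out. *)
  apply: (@poly_eq_nz _ _ _ (A / C)) => x xAC.
  have s0 : A - C * x != 0.
    have [C0|C0] := eqVneq C 0.
      by rewrite C0 mul0r subr0; apply: contraNneq M0 => ->; rewrite C0 mulr0 mul0r subrr.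
    by apply: contraNneq xAC => /eqP; rewrite subr_eq0 => /eqP ->; rewrite mulrAC divff ?mul1r.
  have -> : (fixpoly n a b c d).[x] = x * (c * x ^+ n + d) - (a * x ^+ n + b).
    rewrite /fixpoly -!mul_polyC.
    by rewrite !(hornerXn, hornerD, hornerN, hornerM, hornerX, hornerC).
  rewrite hornerZ horner_prod; under [in RHS]eq_bigr do rewrite hornerXsubC.
  have := congr1 (horner^~ ((E * x - B) / (A - C * x))) GE.
  rewrite FxE scalerA hornerD hornerN !hornerM PE QE hornerZ horner_prod big_tuple.
  have -> : \prod_(i < m.+3) (lin (tnth l i)).[(E * x - B) / (A - C * x)] =
      (\prod_i K (tnth l i)) * (\prod_i (x - t i)) / (A - C * x) ^+ n.+1.
    have sE : (A - C * x) ^+ n.+1 = \prod_(i < m.+3) (A - C * x).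
      by rewrite prodr_const card_ord.
    apply: (mulIf (expf_neq0 n.+1 s0)); rewrite divfK ?expf_neq0 // sE.
    rewrite -!big_split /=.
    by apply: eq_bigr => i _; rewrite mulrC; have [_ ->] := KP i.
  have -> : U.[(E * x - B) / (A - C * x)] = De / (A - C * x) * x.
    by rewrite UE /De; field.
  have -> : V.[(E * x - B) / (A - C * x)] = De / (A - C * x).
    by rewrite VE /De; field.
  rewrite /cst [_ * x ^+ n]mulrC.
  move: (\prod_i (x - t i)) (\prod_i K _) => P K'.
  rewrite exprMn !expr_div_n ![_ ^+ n.+1]exprS -/De.
  have De0 : De != 0 by []; have s0n := expf_neq0 n s0; have D0n := expf_neq0 n De0.
  move: (A - C * x) s0 ((A - C * x) ^+ n) s0n => s s0 sn s0n.
  clear cst; move: De De0 (De ^+ n) D0n (x ^+ n) => De' De'0 Dn Dn0 xn e2.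
  apply: (mulfI (mulf_neq0 De'0 Dn0)); apply: (mulIf (invr_neq0 (mulf_neq0 s0 s0n))).
  transitivity (De' / s * x * (c * (Dn / sn * xn) + d * (Dn / sn)) - De' / s * (a * (Dn / sn * xn) + b * (Dn / sn))).
    by field; rewrite ?s0 ?s0n.
  by rewrite e2; field; rewrite ?s0 ?s0n ?De'0 ?Dn0.
(* The explicit constant need not be simplified: the coefficient of degree n + 1 shows that it is
   c. *)
rewrite {1}HE; congr (_ *: _); have := congr1 (fun P : {poly F} => P`_m.+3) HE.
rewrite coef_fixpoly eqxx coefZ => ->.
have := monicP (monic_prod_XsubC (index_enum 'I_m.+3) xpredT t).
by rewrite lead_coefE size_prod_XsubC /= -[index_enum _]enumT size_enum_ord => ->; rewrite mulr1.
Qed.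

Lemma glocal_deriv_nf n a b c d x : (0 < n)%N -> a * d - b * c != 0 ->
  c * x ^+ n + d != 0 -> glocal_deriv (gnf n a b c d) (Some x) = nf_mult n a b c d x.
Proof.
move=> n0 D0 q0; have cpq := @coprime_nf _ n _ _ _ _ D0.
rewrite (sph_deriveE (sph_derive_ratmap (Some x) cpq)) rdeg_nf ?(det_nz2 D0) //.
rewrite -[gratmap _ _ _]/(gnf n a b c d (Some x)) [X in gnf n _ _ _ _ X]hptS.
rewrite nf_hpt ?(det_nz2 D0) /nz2 ?oner_eq0 ?orbT // expr1n !mulr1 /hpt (negPf q0).
by rewrite /= wron_nf hornerD hornerZ hornerXn hornerC /nf_mult; congr (_ / _); exact: mulrC.
Qed.

Lemma nf_sigma_swap n a b c d : nf_sigma n d c b a = nf_sigma n a b c d.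
Proof.
have D' : d * a - c * b = a * d - b * c by rewrite [d * a]mulrC [c * b]mulrC.
rewrite /nf_sigma /nfY /nfX D' [c * b]mulrC.
by rewrite [X in X / _ + _]addrC [d ^+ n.+1 * _]mulrC [b ^+ n.-1 * _]mulrC.
Qed.

Lemma elem_sym_two_zeros n (t : 'I_n.+1 -> F) i j :
  i != j -> t i = 0 -> t j = 0 -> gelem_sym n t = 0.
Proof.
move=> ij ti tj; rewrite elem_sym_penultimate big1 // => k _.
have [ki|ki] := eqVneq k i.
  by rewrite (bigD1 j) /= ?tj ?mul0r // ki eq_sym.
by rewrite (bigD1 i) /= ?ti ?mul0r // eq_sym.
Qed.

(** Conjugation by 1/z exchanges b and c, so c may be taken nonzero unless b = c = 0. In that last
    case 0 and infinity are both fixed with multiplier 0, so every product of n multipliers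
    vanishes, and so does the closed formula. *)
Lemma sigma_invariant n p q a b c d (l : n.+1.-tuple (option F)) :
  (1 < n)%N -> coprimep p q -> rdeg p q = n -> a * d - b * c != 0 ->
  gconj (gratmap p q) (gnf n a b c d) ->
  (forall z, count_mem z l = gfix_mult n p q z) ->
  gelem_sym n (fun i => glocal_deriv (gratmap p q) (tnth l i)) = nf_sigma n a b c d.
Proof.
case: n l => [|[|m]] // l _ cpq dn D0 fN cl.
have n1 : (1 < rdeg p q)%N by rewrite dn.
have ltnP z : gratmap p q z = z -> z \in l.
  by move/eqP; rewrite -fix_mult_gt0 // dn -cl -has_count has_pred1.
have lfix i : gratmap p q (tnth l i) = tnth l i.
  apply/eqP; rewrite -fix_mult_gt0 // dn -cl -has_count has_pred1.
  exact: mem_tnth.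
wlog c0 : a b c d D0 fN / (c != 0) || ((b == 0) && (c == 0)) => [hw|].
  have [c0|c0] := eqVneq c 0; last by apply: hw => //; rewrite c0.
  have [b0|b0] := eqVneq b 0; first by apply: hw => //; rewrite c0 b0 eqxx orbT.
  rewrite -nf_sigma_swap; apply: hw; last by rewrite b0.
    by rewrite [d * a]mulrC [c * b]mulrC.
  exact: gconj_trans fN (nf_swap _ D0).
have cN := @coprime_nf _ m.+2 _ _ _ _ D0.
have [mu [mmu e]] := fN.
have dN i : glocal_deriv (gratmap p q) (tnth l i) =
    glocal_deriv (gnf m.+2 a b c d) (mu (tnth l i)).
  by rewrite -(multiplier_conj cN mmu e).
case/orP: c0 => [c0|/andP[/eqP b0 /eqP c0]].
  have [t [tE HE]] := conj_fixpoly cpq dn D0 c0 mmu e cl.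
  rewrite -(sigma_roots D0 c0 HE); congr gelem_sym; apply/funext => i.
  by rewrite dN tE glocal_deriv_nf // (denom_neq0 _ D0 HE).
have [nu [mnu e1 e2]] := gmobius_inv mmu.
have muK z : mu (nu z) = z by rewrite -[LHS]/((mu \o nu) z) e1.
have fixnu z : gnf m.+2 a b c d z = z -> nu z \in l.
  move=> Nz; apply: ltnP; apply: (gmobius_inj mmu).
  by rewrite -[LHS]/((mu \o gratmap p q) _) e /= !muK.
have ac := det_nz2 D0.
have [a0 d0] : a != 0 /\ d != 0.
  by apply/andP; rewrite -negb_or -mulf_eq0; move: D0; rewrite b0 mul0r subr0.
have N0 : gnf m.+2 a b c d (Some 0) = Some 0.
  rewrite hptS nf_hpt /nz2 ?oner_eq0 ?orbT // b0 c0 expr0n mulr0n !mulr0 !mul0r !add0r.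
  by rewrite /hpt expr1n mulr1 (negPf d0) oner_eq0 !mul0r.
have Noo : gnf m.+2 a b c d None = None.
  rewrite hptN nf_hpt /nz2 ?oner_eq0 // b0 c0 expr0n mulr0n !mulr0 !mul0r !addr0.
  by rewrite /hpt eqxx.
have [i iE] := tnthP _ _ (fixnu _ N0); have [j jE] := tnthP _ _ (fixnu _ Noo).
have dz z k : tnth l k = nu z -> z = Some 0 \/ z = None -> glocal_deriv (gratmap p q) (tnth l k) = 0.
  move=> kE zE; apply/eqP; rewrite dN kE muK local_deriv_nf_eq0 //.
  by case: zE => ->; rewrite ?eqxx ?orbT.
rewrite (@elem_sym_two_zeros _ _ i j).
- rewrite /nf_sigma /nfX /nfY b0 c0 [m.+2.-1]/= !(mul0r, mulr0) !expr0n !mulr0n.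
  by rewrite !(mulr0, mul0r, addr0).
- apply/eqP => ij; move: iE; rewrite ij -jE => /(gmobius_inj mnu) //.
- by apply: (dz (Some 0)); [rewrite iE|left].
- by apply: (dz None); [rewrite jE|right].
Qed.

End FixedPoints.

(** * The polynomial S whose graph is Per_1(lambda) *)

Section PerCurve.
Variable F : numClosedFieldType.
Implicit Types (a b c d x y w Q k : F).

(* For Q + Q' = 1 - k and Q * Q' = k * x, the numbers x + Q and x + Q' are the
   roots of t^2 - (2 x + 1 - k) t + (x^2 + x); see perT_eval. *)
Fixpoint perT k i : {poly F} :=
  match i with
  | 0%N => ((1 + k) ^+ 2)%:P - (2 * k) *: ('X + 1)
  | i'.+1 => match i' with
    | 0%N => 'X * (((1 + k) ^+ 2)%:P - (2 * k) *: ('X + 1)) +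
             (k * (1 - k) + 4 * k ^+ 2) *: 'X + (k ^+ 2 * (1 - k))%:P
    | i''.+1 => (2 *: 'X + (1 - k)%:P) * perT k i' - ('X^2 + 'X) * perT k i''
    end
  end.

Lemma perTS k i : perT k i.+2 =
  (2 *: 'X + (1 - k)%:P) * perT k i.+1 - ('X^2 + 'X) * perT k i.
Proof. by []. Qed.

Lemma perT_eval k x Q Q' i : Q + Q' = 1 - k -> Q * Q' = k * x ->
  (perT k i).[x] = (Q + k) ^+ 2 * (x + Q') ^+ i + (Q' + k) ^+ 2 * (x + Q) ^+ i.
Proof.
move=> eS eP; have kE : k = 1 - (Q + Q') by rewrite eS; ring.
have key y : y = x + Q \/ y = x + Q' ->
    y ^+ 2 = (2 * x + (1 - k)) * y - (x ^+ 2 + x).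
  move=> yE; apply/eqP; rewrite -subr_eq0.
  rewrite (_ : _ - _ = k * x - Q * Q'); first by rewrite eP subrr.
  by rewrite kE; case: yE => ->; ring.
suff : forall i, ((perT k i).[x] = (Q + k) ^+ 2 * (x + Q') ^+ i + (Q' + k) ^+ 2 * (x + Q) ^+ i) /\
    ((perT k i.+1).[x] = (Q + k) ^+ 2 * (x + Q') ^+ i.+1 + (Q' + k) ^+ 2 * (x + Q) ^+ i.+1).
  by move=> /(_ i)[].
clear i; elim=> [|i [ih1 ih2]].
  have e0 : (Q + k) ^+ 2 + (Q' + k) ^+ 2 = (1 + k) ^+ 2 - 2 * k * (x + 1).
    rewrite -[2 * k * _](_ : 2 * (k * x) + 2 * k = _); last by ring.
    by rewrite -eP kE; ring.
  split.
    rewrite /= !expr0 !mulr1 e0 !(hornerD, hornerN, hornerZ, hornerX, hornerC).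
    by [].
  rewrite /= !(hornerD, hornerN, hornerM, hornerZ, hornerX, hornerC) !expr1.
  rewrite -e0 -!addrA; transitivity (x * ((Q + k) ^+ 2 + (Q' + k) ^+ 2) +
    ((1 - k) * (k * x) + 4 * k * (k * x) + k ^+ 2 * (1 - k))); first by ring.
  by rewrite -eP kE; ring.
split => //; rewrite perTS hornerD hornerN !hornerM ih1 ih2.
rewrite !(hornerD, hornerZ, hornerXn, hornerX, hornerC).
have k1 := key (x + Q) (or_introl erefl); have k2 := key (x + Q') (or_intror erefl).
rewrite [(x + Q') ^+ i.+2](_ : _ = (x + Q') ^+ 2 * (x + Q') ^+ i); last by rewrite -exprD add2n.
rewrite [(x + Q) ^+ i.+2](_ : _ = (x + Q) ^+ 2 * (x + Q) ^+ i); last by rewrite -exprD add2n.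
rewrite k1 k2 !exprS; move: ((x + Q') ^+ i) ((x + Q) ^+ i) => u v.
by ring.
Qed.

(** The coefficient of degree i of [perT k i]. It is quadratic in i because the recurrence gives it
    the constant second difference (1 - k)(-2 k) + 2 k = 2 k^2, produced by the top coefficients -2
    k. *)
Definition pert k (i : nat) : F :=
  1 + k ^+ 2 + i%:R * (k + 3 * k ^+ 2) + k ^+ 2 * i%:R * (i%:R - 1).

(* The coefficient of degree i + 1 cancels in perS below, so that the one of
   degree i determines the point at infinity. *)
Lemma perT_lead k i : exists2 E : {poly F}, (size E <= i)%N &
  perT k i = E + pert k i *: 'X^i - (2 * k) *: 'X^(i.+1).
Proof.
suff : forall i, (exists2 E : {poly F}, (size E <= i)%N &
    perT k i = E + pert k i *: 'X^i - (2 * k) *: 'X^(i.+1)) /\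
    (exists2 E : {poly F}, (size E <= i.+1)%N &
    perT k i.+1 = E + pert k i.+1 *: 'X^(i.+1) - (2 * k) *: 'X^(i.+2)).
  by move=> /(_ i)[].
clear i; elim=> [|i [[E1 s1 e1] [E2 s2 e2]]].
  split.
    exists 0; rewrite ?size_poly0 // /pert /= -!mul_polyC expr0 expr1 mulr1 !mul0r !mulr0 !addr0 mul0r addr0.
    by rewrite !(polyCD, polyCM, polyC_exp); ring.
  exists (k ^+ 2 * (1 - k))%:P; first exact: size_polyC_leq1.
  rewrite /pert /= -!mul_polyC expr1 expr2 subrr mulr0 addr0 mul1r.
  by rewrite !(polyCD, polyCM, polyCB, polyCN, polyC_exp); ring.
split; first by exists E2.
exists ((2 *: 'X + (1 - k)%:P) * E2 - ('X^2 + 'X) * E1 + ((1 - k) * pert k i.+1 - pert k i) *: 'X^(i.+1)).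
  rewrite (leq_trans (size_polyD _ _)) // geq_max; apply/andP; split; last first.
    by rewrite (leq_trans (size_scale_leq _ _)) // size_polyXn.
  rewrite (leq_trans (size_polyD _ _)) // geq_max size_polyN; apply/andP; split.
    rewrite (leq_trans (size_polyMleq _ _)) //.
    have := @size_nf F 1 2 (1 - k); rewrite expr1 => h.
    by rewrite -subn1 leq_subLR (leq_trans (leq_add h s2)) // !addSn.
  rewrite (leq_trans (size_polyMleq _ _)) //.
  have h : (size ('X^2 + 'X : {poly F})%R <= 3)%N.
    by rewrite (leq_trans (size_polyD _ _)) // geq_max size_polyXn size_polyX.
  by rewrite -subn1 leq_subLR (leq_trans (leq_add h s1)) // !addSn.
rewrite perTS e1 e2.
have pE : pert k i.+2 = 2 * pert k i.+1 - pert k i + 2 * k ^+ 2.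
  by rewrite /pert -addn2 -addn1 !natrD; ring.
rewrite pE -!mul_polyC !(polyCD, polyCM, polyCB, polyCN, polyC_exp) !exprS.
move: ('X^i : {poly F}) => Z; ring.
Qed.

Definition perS n (l : F) : {poly F} :=
  let k := l / n%:R in
  n%:R ^+ n *: (k^-1 *: perT k n.-1 + 2 *: 'X^n + (1 - n%:R) *: 'X^(n.-1)).

Lemma perS_eval n l x : (0 < n)%N -> (perS n l).[x] =
  n%:R ^+ n * ((l / n%:R)^-1 * (perT (l / n%:R) n.-1).[x] +
               x ^+ n.-1 * (2 * x + 1 - n%:R)).
Proof.
case: n => // n _; rewrite /perS [n.+1.-1]/=; set k := l / _.
rewrite hornerZ !hornerD !hornerZ !hornerXn [x ^+ n.+1]exprS.
by move: (x ^+ n) (perT k n).[x] => y z; ring.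
Qed.

(** In degree n the contributions -2 and 2 cancel. In degree n - 1, before the factor n^n,
    [pert k (n - 1)] over k plus 1 - n equals 1/k + n^2 k, which for k = l/n is n (l + 1/l). *)
Lemma perS_size n l : (1 < n)%N -> l != 0 ->
  (size (perS n l) <= n)%N /\ (perS n l)`_n.-1 = n%:R ^+ n.+1 * (l + l^-1).
Proof.
case: n => [|[|m]] // _ l0; set n := m.+2; set k := l / n%:R.
have n0 : n%:R != 0 :> F by rewrite pnatr_eq0.
have k0 : k != 0 by rewrite mulf_neq0 ?invr_eq0.
have [E sE TE] := perT_lead k m.+1.
have SE : perS n l = n%:R ^+ n *: (k^-1 *: E + (k^-1 * pert k m.+1 + 1 - n%:R) *: 'X^(m.+1)).
  rewrite /perS -/k [n.-1]/= TE; congr (_ *: _).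
  rewrite !scalerBr !scalerDr !scalerA.
  rewrite (_ : k^-1 * (2 * k) = 2); last by field.
  rewrite scalerBl scalerDl /n -!mul_polyC; ring.
split.
  rewrite SE (leq_trans (size_scale_leq _ _)) // (leq_trans (size_polyD _ _)) // geq_max.
  rewrite (leq_trans (size_scale_leq _ _)) ?(leq_trans sE) //=.
  by rewrite (leq_trans (size_scale_leq _ _)) // size_polyXn.
rewrite SE [n.-1]/= coefZ coefD !coefZ coefXn eqxx mulr1.
rewrite [E`__]nth_default // mulr0 add0r exprSr -mulrA; congr (_ * _).
have m1 : m.+1%:R = n%:R - 1 :> F by rewrite -[n%:R]natr1 addrK.
rewrite /pert m1 /k; move: (n%:R : F) n0 => N N0; field.
by rewrite N0 l0.
Qed.

Definition perShat n l : {poly F} := (n%:R ^+ n.+1)^-1 *: rv n.-1 (perS n l).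

Lemma perShat0 n l : (1 < n)%N -> l != 0 -> (perShat n l).[0] = l + l^-1.
Proof.
move=> n1 l0; have [s e] := perS_size n1 l0.
have n0 : n%:R != 0 :> F by rewrite pnatr_eq0 -lt0n ltnW.
rewrite /perShat hornerZ horner_rv; last by rewrite prednK // ltnW.
by rewrite homogN e mulKf ?expf_neq0.
Qed.

Lemma perShatE n l w : (1 < n)%N -> l != 0 -> w != 0 ->
  (perShat n l).[w] = (perS n l).[w^-1] / (n%:R ^+ n.+1 * w^-1 ^+ n.-1).
Proof.
move=> n1 l0 w0; have [s e] := perS_size n1 l0.
have n0 : n%:R != 0 :> F by rewrite pnatr_eq0 -lt0n ltnW.
rewrite /perShat hornerZ horner_rv; last by rewrite prednK // ltnW.
rewrite /homog (negPf w0) mul1r invfM exprVn invrK.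
by rewrite [w ^+ _ * _]mulrC mulrCA mulrA.
Qed.

(** With e the denominator at x, both Q + k and Q' + k are monomials in the coefficients, x and 1/e.
    From k (X + Q') = Q' (Q + k) and its mirror image, X + Q' and X + Q are monomials over the
    determinant, so the two summands of [perT_eval] are, up to k, those of Y. *)
Lemma nf_fixed_sigma n a b c d x l : (1 < n)%N -> a * d - b * c != 0 -> l != 0 ->
  x != 0 -> c * x ^+ n + d != 0 -> x * (c * x ^+ n + d) = a * x ^+ n + b ->
  nf_mult n a b c d x = l -> nf_sigma n a b c d = (perS n l).[nfX a b c d].
Proof.
case: n => [|[|m]] // _; set n := m.+2 => D0 l0 x0 e0 fx ml.
set X := nfX a b c d; rewrite perS_eval // /nf_sigma -/X; congr (_ * (_ + _)).
have n0 : n%:R != 0 :> F by rewrite pnatr_eq0.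
set k := l / n%:R; have k0 : k != 0 by rewrite mulf_neq0 ?invr_eq0.
set e := c * x ^+ n + d in e0 fx; have eE : e = c * x ^+ n + d by [].
have kE : k = x ^+ m.+1 * (a * d - b * c) / e ^+ 2.
  by rewrite /k -ml /nf_mult -/e [n.-1]/=; field; rewrite e0 n0.
have y0 : x ^+ m.+1 != 0 by rewrite expf_neq0.
have xE : x ^+ n = x * x ^+ m.+1 by exact: exprS.
pose Q := c * x ^+ n / e; pose Q' := b / (x * e).
have g0 : a * x ^+ n + b != 0 by rewrite -fx mulf_neq0.
have Qk : Q' + k = d / e.
  rewrite kE /Q'.
  have -> : x ^+ m.+1 * (a * d - b * c) / e ^+ 2 = x ^+ n * (a * d - b * c) / (x * e * e).
    by rewrite xE; field; rewrite e0 x0.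
  apply: (mulIf (mulf_neq0 (mulf_neq0 x0 e0) e0)).
  transitivity (b * e + x ^+ n * (a * d - b * c)); first by field; rewrite e0 x0.
  transitivity (d * (x * e)); last by field.
  by rewrite fx eE; ring.
have Qk2 : Q + k = a * x ^+ n / (x * e).
  rewrite kE /Q.
  have -> : x ^+ m.+1 * (a * d - b * c) / e ^+ 2 = x ^+ n * (a * d - b * c) / (x * e * e).
    by rewrite xE; field; rewrite e0 x0.
  apply: (mulIf (mulf_neq0 (mulf_neq0 x0 e0) e0)).
  transitivity (c * x ^+ n * (x * e) + x ^+ n * (a * d - b * c)); first by field; rewrite e0 x0.
  transitivity (a * x ^+ n * e); last by field; rewrite e0 x0.
  by rewrite fx eE; ring.
have Qsum : Q + Q' = 1 - k.
  apply/eqP; rewrite eq_sym subr_eq -addrA Qk /Q -mulrDl -eE divff //.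
have Qprod : Q * Q' = k * X.
  rewrite /Q /Q' kE /X /nfX xE; move: (x ^+ m.+1) y0 => y y0.
  by field; rewrite e0 x0 D0.
rewrite (perT_eval _ Qsum Qprod) Qk Qk2.
have X1 : X + Q' = a * b / (x * (a * d - b * c)).
  apply: (mulfI k0); rewrite mulrDr -Qprod -mulrDl Qk2 /Q' kE xE.
  by move: (x ^+ m.+1) y0 => y y0; field; rewrite ?e0 ?x0 ?D0.
have X2 : X + Q = c * d * x / (a * d - b * c).
  apply: (mulfI k0); rewrite mulrDr -Qprod [k * Q]mulrC -mulrDr Qk /Q kE xE.
  by move: (x ^+ m.+1) y0 => y y0; field; rewrite ?e0 ?x0 ?D0.
rewrite X1 X2 kE /nfY [n.-1]/= xE /n.
have := expf_neq0 m.+1 D0; clear -D0 e0 x0; move: e e0 => e e0 D'0.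
set y := x ^+ m.+1; have y0 : y != 0 by rewrite expf_neq0.
rewrite !expr_div_n !exprMn ![_ ^+ m.+3]exprS ![_ ^+ m.+2]exprS -/y.
move: ((a * d - b * c) ^+ m.+1) D'0 (a ^+ m.+1) (b ^+ m.+1) (c ^+ m.+1) (d ^+ m.+1).
move: y y0 => y y0 D' D'0 A' B' C' E'.
by field; rewrite ?e0 ?x0 ?D0 ?y0 ?D'0.
Qed.

Lemma per_root_exists k x : exists Q, Q * (1 - k - Q) = k * x.
Proof.
pose s := sqrtC ((1 - k) ^+ 2 - 4 * (k * x)).
have s2 : s ^+ 2 = (1 - k) ^+ 2 - 4 * (k * x) by rewrite sqrtCK.
exists ((1 - k + s) / 2).
transitivity (((1 - k) ^+ 2 - s ^+ 2) / 4); first by field.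
by rewrite s2; field.
Qed.

(* Coefficients normalized by a + b = c + d = 1, which makes 1 a fixed point. *)
Lemma per_model n l x : (1 < n)%N -> l != 0 -> exists a b c d,
  [/\ a * d - b * c != 0, nfX a b c d = x, gnf n a b c d (Some 1) = Some 1
    & glocal_deriv (gnf n a b c d) (Some 1) = l /\
      nf_sigma n a b c d = (perS n l).[x]].
Proof.
move=> n1 l0; have n0 : n%:R != 0 :> F by rewrite pnatr_eq0 -lt0n ltnW.
set k := l / n%:R; have k0 : k != 0 by rewrite mulf_neq0 ?invr_eq0.
have [Q QE] := per_root_exists k x.
pose a := Q + k; pose b := 1 - k - Q; pose c := Q; pose d := 1 - Q.
have DE : a * d - b * c = k by rewrite /a /b /c /d; ring.
have D0 : a * d - b * c != 0 by rewrite DE.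
have XE : nfX a b c d = x.
  rewrite /nfX DE (_ : b * c = k * x); last by rewrite mulrC; exact: QE.
  by rewrite mulrAC divff ?mul1r.
have cd : c * 1 ^+ n + d = 1 by rewrite expr1n mulr1 /c /d; ring.
have ab : a * 1 ^+ n + b = 1 by rewrite expr1n mulr1 /a /b; ring.
have q0 : c * 1 ^+ n + d != 0 by rewrite cd oner_neq0.
have mE : nf_mult n a b c d 1 = l.
  by rewrite /nf_mult cd DE !expr1n mulr1 divr1 /k mulrCA divff ?mulr1.
exists a, b, c, d; split => //.
  have w1 : nz2 1 (1 : F) by rewrite /nz2 oner_neq0.
  rewrite [Some 1]hptS nf_hpt ?(ltnW n1) ?(det_nz2 D0) //.
  by move: ab cd; rewrite !expr1n !mulr1 => -> ->.
split; first by rewrite glocal_deriv_nf // ltnW.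
rewrite -XE; apply: (nf_fixed_sigma n1 D0 l0 (oner_neq0 _) q0) => //.
by rewrite cd ab mulr1.
Qed.

(** A nonzero multiplier excludes the critical points 0 and infinity, so the corresponding fixed
    point of the normal form is finite and nonzero. *)
Lemma per_conj_sigma n f a b c d z l : (1 < n)%N -> a * d - b * c != 0 -> l != 0 ->
  gconj f (gnf n a b c d) -> f z = z -> glocal_deriv f z = l ->
  nf_sigma n a b c d = (perS n l).[nfX a b c d].
Proof.
move=> n1 D0 l0 [mu [mmu e]] fz dl; have ac := det_nz2 D0; have n0 := ltnW n1.
have Nmu : gnf n a b c d (mu z) = mu z.
  by rewrite -[LHS]/((gnf n a b c d \o mu) z) -e /= fz.
have dN : glocal_deriv (gnf n a b c d) (mu z) = l.
  by rewrite -dl; apply: multiplier_conj mmu e fz; exact: coprime_nf.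
have : glocal_deriv (gnf n a b c d) (mu z) != 0 by rewrite dN.
rewrite local_deriv_nf_eq0 // negb_or => /andP[].
case: (mu z) Nmu dN => [x|] // Nx dN x0 _.
have {}x0 : x != 0 by apply: contraNneq x0 => ->.
have w1 : nz2 x 1 by rewrite /nz2 oner_neq0 orbT.
move: (Nx); rewrite [Some x]hptS nf_hpt // expr1n !mulr1 => /hpt_cross.
rewrite mulr1 => fx.
have q0 : c * x ^+ n + d != 0.
  apply: contra_eqN Nx => /eqP q0.
  by rewrite [X in gnf _ _ _ _ _ X]hptS nf_hpt // expr1n !mulr1 q0 /hpt eqxx.
by apply: (nf_fixed_sigma n1 D0 l0 x0 q0); rewrite ?fx // -dN glocal_deriv_nf.
Qed.

(** For given X, sigma_n is an affine function of Y with slope n^n. *)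
Lemma nf_sigma_conj n a b c d a' b' c' d' : (1 < n)%N ->
  a * d - b * c != 0 -> a' * d' - b' * c' != 0 ->
  nfX a b c d = nfX a' b' c' d' -> nf_sigma n a b c d = nf_sigma n a' b' c' d' ->
  gconj (gnf n a b c d) (gnf n a' b' c' d').
Proof.
move=> n1 D0 D0' eX; have n0 : n%:R != 0 :> F by rewrite pnatr_eq0 -lt0n ltnW.
rewrite /nf_sigma eX => /(mulfI (expf_neq0 n n0))/addIr.
exact: nf_conj_XY.
Qed.

End PerCurve.

(** * Graphs of polynomials: topology and equations *)

Section GraphTopology.
Variable F : numClosedFieldType.
Implicit Types (S : {poly F}).

Lemma continuous_graph S : continuous (fun x : F => (x, S.[x]) : F * F).
Proof.
move=> x; exact: (@cvg_pair F F F (nbhs x) (nbhs x) (nbhs S.[x]) _ _ _ id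
  (fun y => S.[y]) (@cvg_id _ _) (@continuous_horner_poly _ S x)).
Qed.

Lemma open_preimage_graph S (W : set (F * F)) :
  open W -> open ((fun x : F => (x, S.[x])) @^-1` W).
Proof. by move: W; apply/continuousP; exact: continuous_graph. Qed.

Lemma open_graphC S : open [set u : F * F | u.2 != S.[u.1]].
Proof.
rewrite openE => -[x y] /= nS; rewrite /interior.
have : (fun u : F * F => u.2 - S.[u.1]) @ nbhs (x, y) --> y - S.[x].
  apply: cvgB; first exact: cvg_snd.
  apply: (@cvg_comp _ _ _ fst (fun z => S.[z]) _ (nbhs x)); first exact: cvg_fst.
  exact: continuous_horner_poly.
move=> /cvgr_neq0; rewrite subr_eq0 => /(_ nS).
by apply: filterS => u; rewrite subr_eq0.
Qed.

(** Serves to approach the point of the curve at infinity by points at finite distance. *)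
Lemma nbhs0_neq0 (B : set F) : nbhs (0 : F) B -> exists2 w, w != 0 & B w.
Proof.
move=> B0; have : (0 : F)^' (fun w => w != 0 /\ B w).
  near=> w; split.
    by near: w; exact: nbhs_dnbhs_neq.
  by near: w; exact: nbhs_dnbhs.
by move=> /filter_ex[w [w0 Bw]]; exists w.
Unshelve. all: by end_near. Qed.

Lemma derivable_horner_poly S x : derivable (fun y : F => S.[y] : F) x 1.
Proof. by case: (is_derive_horner S x). Qed.

Definition graph_poly S : {poly {poly F}} := 'X - S%:P.

Lemma graph_polyE S x y : (graph_poly S).[y%:P].[x] = y - S.[x].
Proof. by rewrite /graph_poly !hornerE. Qed.

Lemma graph_poly_nonconst S c : graph_poly S <> c%:P%:P.
Proof.
move=> /(congr1 (fun P : {poly {poly F}} => size P)).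
by rewrite /graph_poly size_XsubC size_polyC; case: (_ != 0).
Qed.

Lemma deriv_graph_poly S x y : ((graph_poly S)^`()).[y%:P].[x] = 1.
Proof. by rewrite /graph_poly derivB derivX derivC subr0 !hornerE. Qed.

End GraphTopology.

Lemma sqrt_sumsq_le (R : rcfType) (a b : R) :
  Num.sqrt (a ^+ 2 + b ^+ 2) <= `|a| + `|b|.
Proof.
have -> : `|a| + `|b| = Num.sqrt ((`|a| + `|b|) ^+ 2).
  by rewrite sqrtr_sqr [RHS]ger0_norm ?addr_ge0.
rewrite ler_wsqrtr // sqrrD.
by rewrite !real_normK ?num_real // lerD2r lerDl mulrn_wge0 // mulr_ge0.
Qed.

Lemma norm_le_sqrt_sumsq (R : rcfType) (a b : R) :
  `|a| <= Num.sqrt (a ^+ 2 + b ^+ 2).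
Proof. by rewrite -sqrtr_sqr ler_wsqrtr // lerDl sqr_ge0. Qed.

(** The image of the square [-1, 1]^2 under x + i y: a compact set containing the disc is enough for
    the covering argument. *)
Lemma unit_disc_compact (R : realType) :
  exists2 K : set (Cplx R), compact K & forall x, `|x| <= 1 -> K x.
Proof.
pose h (u : R * R) : Cplx R := (u.1 +i* u.2)%C.
have ch : continuous h.
  move=> u; apply/cvgrPdist_lt => e e0.
  (* In the order of C, a positive e is a real number, so its real part serves as a real radius. *)
  have [r r0 re] : exists2 r : R, 0 < r & (r%:C)%C <= e.
    exists (complex.Re e).
      by move: e0; rewrite ltcE => /andP[].
    by move: e0; rewrite ltcE lecE /= => /andP[/eqP -> _]; rewrite eqxx lexx.
  have r2 : 0 < r / 2 by rewrite divr_gt0.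
  have n1 : \forall v \near u, `|u.1 - v.1| < r / 2.
    have c1 : (fun v : R * R => v.1) v @[v --> u] --> u.1 by exact: cvg_fst.
    by move/cvgrPdist_lt: c1 => /(_ _ r2).
  have n2 : \forall v \near u, `|u.2 - v.2| < r / 2.
    have c2 : (fun v : R * R => v.2) v @[v --> u] --> u.2 by exact: cvg_snd.
    by move/cvgrPdist_lt: c2 => /(_ _ r2).
  move: n1 n2; apply: filter_app2; near=> v => h1 h2; apply: lt_le_trans re.
  rewrite normc_def ltcR (le_lt_trans (sqrt_sumsq_le _ _)) //.
  by rewrite [ltRHS]splitr ltrD.
exists (h @` (`[(-1 : R), 1] `*` `[(-1 : R), 1])).
  apply: continuous_compact; first exact: continuous_subspaceT.
  by apply: compact_setX; exact: segment_compact.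
move=> x x1; exists (complex.Re x, complex.Im x); last by case: x {x1}.
move: x1; rewrite normc_def lecR => x1.
by split; rewrite /= in_itv /= -ler_norml (le_trans _ x1) //;
  [exact: norm_le_sqrt_sumsq|rewrite addrC; exact: norm_le_sqrt_sumsq].
Unshelve. all: by end_near. Qed.

(** * X and sigma_n as coordinates on moduli space, and Per_1 as a graph *)

Section Moduli.
Variables (R : realType) (n : nat).
Hypothesis n1 : (1 < n)%N.
Local Notation C := (Cplx R).
Implicit Types (m : moduli R n) (a b c d x w l : C).

Lemma moduli_eq m m' : mclass m = mclass m' -> m = m'.
Proof.
case: m m' => A hA [B hB] /= e; case: _ / e in hB *.
by congr Moduli; exact: Prop_irrelevance.
Qed.

Lemma class_normal_form m : exists a b c d : C, a * d - b * c != 0 /\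
  mclass m = [set g | gconj (gnf n a b c d) g].
Proof.
have [f [[p [q [cpq dn fE]]] [z1 [z2 [z12 crit]]]] ->] := mclassP m.
have dn' : rdeg p q = n by [].
have critP z : glocal_deriv (gratmap p q) z = 0 -> z = z1 \/ z = z2.
  move=> h; have : critical_points f z by rewrite fE; exact: h.
  by rewrite crit.
have n1' : (1 < rdeg p q)%N by rewrite dn'.
have [a [b [c [d [D0 h]]]]] := gconj_normal_form cpq n1' z12 critP.
exists a, b, c, d; split => //; rewrite dn' in h; rewrite fE.
apply/seteqP; split => g; first exact: gconj_trans (gconj_sym h).
exact: gconj_trans h.
Qed.

Lemma nf_class a b c d : a * d - b * c != 0 ->
  exists m, mclass m = [set g | gconj (gnf n a b c d) g].
Proof.
move=> D0; have n0 := ltnW n1.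
have B : exists2 f, bicritical n f &
    [set g | gconj (gnf n a b c d) g] = [set g | mobius_conj f g].
  exists (gnf n a b c d); last by [].
  split.
    exists (a *: 'X^n + b%:P), (c *: 'X^n + d%:P); split => //.
      exact: coprime_nf.
    by have := rdeg_nf b d n0 (det_nz2 D0).
  exists (Some 0), None; split => //; apply/seteqP; split => z.
    move=> h; have : glocal_deriv (gnf n a b c d) z == 0 by apply/eqP; exact: h.
    by rewrite local_deriv_nf_eq0 // => /orP[] /eqP ->; [left|right].
  move=> h; suff : glocal_deriv (gnf n a b c d) z == 0 by move/eqP.
  by rewrite local_deriv_nf_eq0 //; case: h => ->; rewrite eqxx ?orbT.
by exists (Moduli B).
Qed.

Lemma X_invE m a b c d : a * d - b * c != 0 ->
  mclass m = [set g | gconj (gnf n a b c d) g] -> X_inv m = nfX a b c d.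
Proof.
move=> D0 mE; apply: xget_unique.
  by exists a, b, c, d; split => //; rewrite mE; exact: gconj_refl.
move=> y [a' [b' [c' [d' [D0' + ->]]]]]; rewrite mE => h.
exact/esym/(nf_conj_X n1 D0 D0' h).
Qed.

(** The set from which [xget] chooses is a singleton: [fixed_points_exist] provides an element and
    [sigma_invariant] makes it independent of the representative and of the list of fixed points. *)
Lemma sigmaE m a b c d : a * d - b * c != 0 ->
  mclass m = [set g | gconj (gnf n a b c d) g] ->
  sigma n m = nf_sigma n a b c d.
Proof.
move=> D0 mE; have n0 := ltnW n1.
have key f (l : n.+1.-tuple (sphere R)) : mclass m f -> fixed_points f l ->
    elem_sym n (fun i => multiplier f (tnth l i)) = nf_sigma n a b c d.
  rewrite mE => cf [p [q [[cpq dn fE] cl]]]; rewrite fE in cf *.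
  exact: (sigma_invariant n1 cpq dn D0 (gconj_sym cf) cl).
apply: xget_unique; last by move=> y [f [l [mf fl ->]]]; exact: key.
have cpq := @coprime_nf _ n _ _ _ _ D0.
have dn := rdeg_nf b d n0 (det_nz2 D0).
have mf : mclass m (gnf n a b c d) by rewrite mE; exact: gconj_refl.
have [l fl] : exists l : n.+1.-tuple (sphere R), fixed_points (gnf n a b c d) l.
  have := fixed_points_exist cpq; rewrite dn => /(_ n1)[l cl].
  by exists l, (a *: 'X^n + b%:P), (c *: 'X^n + d%:P).
by exists (gnf n a b c d), l; split => //; rewrite (key _ _ mf fl).
Qed.

Lemma moduli_inj m m' : X_inv m = X_inv m' -> sigma n m = sigma n m' -> m = m'.
Proof.
have [a [b [c [d [D0 mE]]]]] := class_normal_form m.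
have [a' [b' [c' [d' [D0' mE']]]]] := class_normal_form m'.
rewrite (X_invE D0 mE) (X_invE D0' mE') (sigmaE D0 mE) (sigmaE D0' mE') => eX eS.
have h := nf_sigma_conj n1 D0 D0' eX eS.
apply: moduli_eq; rewrite mE mE'; apply/seteqP; split => g.
  exact: gconj_trans (gconj_sym h).
exact: gconj_trans h.
Qed.

Lemma Per1_exists l x : l != 0 ->
  exists m, [/\ Per1 l m, X_inv m = x & sigma n m = (perS n l).[x]].
Proof.
move=> l0; have [a [b [c [d [D0 eX N1 [dN eS]]]]]] := per_model x n1 l0.
have [m mE] := nf_class D0; exists m; split.
- by exists (gnf n a b c d), (Some 1); split => //; rewrite mE; exact: gconj_refl.
- by rewrite (X_invE D0 mE).
- by rewrite (sigmaE D0 mE).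
Qed.

(** For the converse no fixed point is sought in the given class. A class with the same X and a
    fixed point of multiplier l exists, its sigma_n is also the value of S, and X and sigma_n
    determine the class. *)
Lemma Per1P l m : l != 0 -> Per1 l m <-> sigma n m = (perS n l).[X_inv m].
Proof.
move=> l0; split => [|e]; last first.
  have [m' [Pm' eX eS]] := Per1_exists (X_inv m) l0.
  by rewrite (@moduli_inj m m') // ?eX // eS.
have [a [b [c [d [D0 mE]]]]] := class_normal_form m.
move=> [f [z [mf fz dz]]]; rewrite (X_invE D0 mE) (sigmaE D0 mE).
apply: (per_conj_sigma n1 D0 l0 _ fz dz).
by move: mf; rewrite mE => /gconj_sym.
Qed.

End Moduli.

(** * Closure of a polynomial graph in the extended moduli space *)

Section GraphClosure.
Variables (R : realType) (n : nat).
Local Notation C := (Cplx R).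
Local Notation E := (ext_moduli R n).
(** Only this is used of Per_1: it is the graph of S in the finite chart, and the change of charts
    turns S into a polynomial T, regular at 0. *)
Variables (S T : {poly C}) (Per : set (moduli R n)).
Hypothesis n1 : (1 < n)%N.
Hypothesis TE : forall w : C, w != 0 ->
  T.[w] = S.[w^-1] / (n%:R ^+ n.+1 * w^-1 ^+ n.-1).
Hypothesis PerP : forall m, Per m <-> sigma n m = S.[X_inv m].
Variable s : sphere R -> E.
Hypothesis s_fin : forall x : C,
  exists m, [/\ s (Some x) = mfin m, X_inv m = x & sigma n m = S.[x]].
Hypothesis s_inf : s None = minf n T.[0].

Let g1 (x : C) : E := s (Some x).
Let g2 (w : C) : E := s (sphere_inv (Some w)).

Lemma fin_chart_section (x : C) : fin_chart (g1 x) = (x, S.[x]).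
Proof. by have [m [sx mX ms]] := s_fin x; rewrite /g1 sx /= mX ms. Qed.

Lemma fin_dom_section (x : C) : fin_dom (g1 x).
Proof. by have [m [sx _ _]] := s_fin x; exists m. Qed.

Lemma inf_section (w : C) : inf_dom (g2 w) /\ inf_chart (g2 w) = (w, T.[w]).
Proof.
rewrite /g2 /=; have [->|w0] := eqVneq w 0; first by rewrite s_inf.
have [m [sx mX ms]] := s_fin w^-1; rewrite sx /= mX ms invrK TE //; split => //.
by apply/eqP; rewrite invr_eq0.
Qed.

Lemma range_fin m : range s (mfin m) <-> sigma n m = S.[X_inv m].
Proof.
split=> [[[x|] _]|e].
- by have [m' [-> <- ?]] := s_fin x => -[<-].
- by rewrite s_inf.
have [m' [sx mX ms]] := s_fin (X_inv m).
by exists (Some (X_inv m)) => //; rewrite sx (@moduli_inj R n n1 m' m) // ms e.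
Qed.

Lemma range_inf p : inf_dom p ->
  range s p <-> (inf_chart p).2 = T.[(inf_chart p).1].
Proof.
case: p => [m|t] /= pd; last first.
  split=> [[[x|] _]|->]; last by exists None.
    by have [m' [-> _ _]] := s_fin x.
  by rewrite s_inf => -[<-].
have m0 : X_inv m != 0 by apply/eqP.
have K0 : n%:R ^+ n.+1 * X_inv m ^+ n.-1 != 0.
  by rewrite mulf_neq0 ?expf_neq0 // pnatr_eq0 -lt0n ltnW.
rewrite -[X in X <-> _]/(range s (mfin m)) range_fin TE ?invr_eq0 // invrK; split => [->//|].
by move/(congr1 (fun x => x * (n%:R ^+ n.+1 * X_inv m ^+ n.-1))); rewrite !divfK.
Qed.

Lemma Per_rangeE : @mfin R n @` Per = range s `&` @fin_dom R n.
Proof.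
apply/seteqP; split=> p.
  by move=> [m /PerP Pm <-]; split; [exact/range_fin|exists m].
by move=> [sp [m _ pE]]; exists m => //; apply/PerP/range_fin; rewrite pE.
Qed.

Lemma continuous_section_fin : continuous g1.
Proof.
apply/continuousP => U [[W oW UW] _].
rewrite (_ : _ @^-1` _ = (fun x : C => (x, S.[x]) : C * C) @^-1` W).
  exact: (@open_preimage_graph C S W oW).
have h x : U (g1 x) = W (x, S.[x]).
  have := congr1 (fun A : set E => A (g1 x)) UW.
  rewrite /setI /= /preimage /= fin_chart_section => e.
  by apply/propext; split=> h; [have [] : W (x, S.[x]) /\ fin_dom (g1 x)
    by rewrite -e; split; [|exact: fin_dom_section]
    |have [] : U (g1 x) /\ fin_dom (g1 x)
    by rewrite e; split; [|exact: fin_dom_section]].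
by apply/funext => x; rewrite /preimage /= h.
Qed.

Lemma continuous_section_inf : continuous g2.
Proof.
apply/continuousP => U [_ [W oW UW]].
rewrite (_ : _ @^-1` _ = (fun x : C => (x, T.[x]) : C * C) @^-1` W).
  exact: (@open_preimage_graph C T W oW).
have h x : U (g2 x) = W (x, T.[x]).
  have [dx cx] := inf_section x.
  have := congr1 (fun A : set E => A (g2 x)) UW.
  rewrite /setI /= /preimage /= cx => e.
  by apply/propext; split=> h; [have [] : W (x, T.[x]) /\ inf_dom (g2 x)
    by rewrite -e
    |have [] : U (g2 x) /\ inf_dom (g2 x) by rewrite e].
by apply/funext => x; rewrite /preimage /= h.
Qed.

(** In each chart the complement is that of a polynomial graph, which is open. *)
Lemma closed_range_section : closed (range s).
Proof.
rewrite -openC; split.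
  exists [set u : C * C | u.2 != S.[u.1]]; first exact: open_graphC.
  apply/seteqP; split=> p [h [m _ pE]]; subst p; split; [|by exists m| |by exists m].
    by apply/eqP => e; apply: h; apply/range_fin.
  by move=> /range_fin e; move: h; rewrite /preimage /= e eqxx.
exists [set u : C * C | u.2 != T.[u.1]]; first exact: open_graphC.
apply/seteqP; split=> p [h pd]; split => //.
  by apply/eqP => e; apply: h; apply/(range_inf pd).
by move=> /(range_inf pd) e; move: h; rewrite /preimage /= e eqxx.
Qed.

(** The image of the section is closed and exceeds the curve by the single point over infinity,
    which is the limit of [g2 w] for nonzero w tending to 0. *)
Lemma closure_Per : closure (@mfin R n @` Per) = range s.
Proof.
apply/seteqP; split.
  rewrite closureE => p; apply; split; first exact: closed_range_section.
  by rewrite Per_rangeE; exact: subIsetl.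
move=> _ [[x|] _ <-].
  by apply: subset_closure; rewrite Per_rangeE; split; [exists (Some x)|exact: fin_dom_section].
have g20 : g2 0 = s None by rewrite /g2 /= eqxx.
rewrite -g20 => B /continuous_section_inf /nbhs0_neq0[w w0 Bw].
exists (g2 w); split => //; rewrite Per_rangeE; split; first by exists (sphere_inv (Some w)).
by rewrite /g2 /= (negPf w0); exact: fin_dom_section.
Qed.

Lemma graph_locus (A : {poly C}) :
  [set u : C * C | u.2 = A.[u.1]] = zero_locus (graph_poly A).
Proof.
apply/seteqP; split=> u; rewrite /zero_locus /eval2 /= graph_polyE.
  by move=> ->; rewrite subrr.
by move/eqP; rewrite subr_eq0 => /eqP.
Qed.

Lemma smooth_graph (A : {poly C}) : smooth_zero_locus [set u : C * C | u.2 = A.[u.1]].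
Proof.
exists (graph_poly A); split; first exact: graph_locus.
by move=> u _; right; rewrite /eval2 deriv_graph_poly; apply/eqP; exact: oner_neq0.
Qed.

Lemma fin_chart_range :
  @fin_chart R n @` (range s `&` @fin_dom R n) = [set u : C * C | u.2 = S.[u.1]].
Proof.
apply/seteqP; split=> u.
  by move=> [p [sp [m _ pE]] <-]; subst p; exact/range_fin.
case: u => x y /= ->; exists (g1 x); last exact: fin_chart_section.
by split; [exists (Some x)|exact: fin_dom_section].
Qed.

Lemma inf_chart_range :
  @inf_chart R n @` (range s `&` @inf_dom R n) = [set u : C * C | u.2 = T.[u.1]].
Proof.
apply/seteqP; split=> u; first by move=> [p [sp pd] <-]; exact/(range_inf pd).
case: u => w y /= ->; have [dw cw] := inf_section w.
by exists (g2 w) => //; split => //; exists (sphere_inv (Some w)).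
Qed.

(** The sphere is covered by the discs |x| <= 1 and |1/x| <= 1, on which the section is read by [g1]
    and [g2]. The image is thus a closed subset of a union of two compact sets. *)
Lemma compact_range_section : compact (range s).
Proof.
have [K cK Kd] := unit_disc_compact R.
have c12 : compact (g1 @` K `|` g2 @` K).
  by apply: compactU; apply: continuous_compact => //;
    apply: continuous_subspaceT; [exact: continuous_section_fin|exact: continuous_section_inf].
apply: (subclosed_compact closed_range_section c12) => _ [[x|] _ <-]; last first.
  right; exists 0; last by rewrite /g2 /= eqxx.
  by apply: Kd; rewrite normr0.
have [x1|x1] := real_leP (normr_real x) (real1 C); first by left; exists x => //; exact: Kd.
have x0 : x != 0 by rewrite -normr_gt0 (lt_trans _ x1).
right; exists x^-1; last by rewrite /g2 /= invr_eq0 (negPf x0) invrK.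
by apply: Kd; rewrite normfV invf_le1 ?ltW // (lt_trans _ x1).
Qed.

Lemma smooth_section_graph : smooth_section s.
Proof.
split.
- by case=> [x|]; [have [m [-> <- _]] := s_fin x|rewrite s_inf].
- rewrite (_ : (fun _ => _) = (fun x : C => S.[x])).
    by move=> x; exact: derivable_horner_poly.
  by apply/funext => x; rewrite -/(g1 x) fin_chart_section.
- rewrite (_ : (fun _ => _) = (fun x : C => T.[x])).
    by move=> x; exact: derivable_horner_poly.
  by apply/funext => x; rewrite -/(g2 x) (inf_section x).2.
Qed.

Lemma graph_closure : let PerM := @mfin R n @` Per in
  [/\ affine_curve (@fin_chart R n @` PerM), smooth_algebraic_curve (closure PerM),
      compact (closure PerM), smooth_section s /\ closure PerM = range s
    & closure PerM `&` @Linf R n = [set minf n T.[0]]].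
Proof.
rewrite /= closure_Per; split.
- exists (graph_poly S); split; first exact: graph_poly_nonconst.
  by rewrite Per_rangeE fin_chart_range graph_locus.
- split; first by exists (s None), None.
    by rewrite fin_chart_range; exact: smooth_graph.
  by rewrite inf_chart_range; exact: smooth_graph.
- exact: compact_range_section.
- by split; first exact: smooth_section_graph.
apply/seteqP; split=> p.
  by move=> [sp [t _ pE]]; subst p; have /(@range_inf (minf n t) I) /= -> := sp.
by move=> ->; split; [exists None|exists T.[0]].
Qed.

End GraphClosure.

Theorem corollary6p5 (R : realType) (n : nat) (hn : (2 <= n)%N)
    (lambda : Cplx R) (hlambda : lambda != 0) :
  let PerM : set (ext_moduli R n) := @mfin R n @` @Per1 R n lambda in
  let PerBar : set (ext_moduli R n) := closure PerM in
  [/\ affine_curve (@fin_chart R n @` PerM),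
      smooth_algebraic_curve PerBar,
      compact PerBar,
      (exists s : sphere R -> ext_moduli R n,
         smooth_section s /\ PerBar = range s)
    & exists p : ext_moduli R n,
        PerBar `&` @Linf R n = [set p] /\
        inf_chart p = (0, lambda + lambda^-1)].
Proof.
have /choice[f fP] : forall x, exists m : moduli R n,
    X_inv m = x /\ sigma n m = (perS n lambda).[x].
  by move=> x; have [m [_ mX ms]] := Per1_exists hn x hlambda; exists m.
have T0 := perShat0 hn hlambda.
have TE w := @perShatE _ n lambda w hn hlambda.
(* The classes picked by choice are the only possible ones, since X and sigma_n determine the
   class. *)
pose s z := if z is Some x then mfin (f x) else minf n (lambda + lambda^-1).
have s_fin x : exists m,
    [/\ s (Some x) = mfin m, X_inv m = x & sigma n m = (perS n lambda).[x]].
  by exists (f x); have [] := fP x.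
have s_inf : s None = minf n (perShat n lambda).[0] by rewrite T0.
have [? ? ? ? e] := graph_closure hn TE (fun m => Per1P hn m hlambda) s_fin s_inf.
split => //; first by exists s.
by exists (minf n (lambda + lambda^-1)); rewrite -T0.
Qed.
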